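(* Let $k\geq 3$ be an integer which is not of the form $4t^4-4t+2$ with $t\in\mathbb{Z}\setminus\{0,1\}$. Then there exists a complex cubic number field $K$ (a cubic field with exactly one real embedding) with $\ell(K)=k$.
   Context: For a number field $K$, ''units'' means units of its ring of integers. A sum $\varepsilon_1+\dots+\varepsilon_k$ has a proper vanishing subsum if there is a nonempty proper subset $I\subsetneq\{1,\dots,k\}$ with $\sum_{i\in I}\varepsilon_i=0$. $\mathrm{od}(K)$ is the smallest odd $k\geq 3$ such that there exist units $\varepsilon_1,\dots,\varepsilon_k$ of $K$ with $\varepsilon_1+\dots+\varepsilon_k=0$ ($\infty$ if none exists). $\mathrm{ev}(K)$ is the smallest even $k\geq 4$ such that there exist units $\varepsilon_1,\dots,\varepsilon_k$ of $K$ with $\varepsilon_1+\dots+\varepsilon_k=0$ and no proper vanishing subsum ($\infty$ if none exists). $\ell(K)=\min(\mathrm{od}(K),\mathrm{ev}(K))$. *)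

(* Defs.v *)
From HB Require Import structures.
From mathcomp Require Import all_boot all_order all_algebra all_field.
From mathcomp Require Import boolp reals constructive_ereal.

Set Implicit Arguments.
Unset Strict Implicit.
Unset Printing Implicit Defensive.

Import Order.TTheory GRing.Theory Num.Theory.

Local Open Scope ring_scope.

(* A number field is a K : fieldExtType rat; its degree is \dim {:K}. *)

Definition is_integer (K : fieldExtType rat) (x : K) : Prop :=
  integralOver (intr : int -> K) x.

Definition is_unit (K : fieldExtType rat) (x : K) : Prop :=
  is_integer x /\ exists2 y : K, is_integer y & x * y = 1.

Definition unit_vanishing_sum (K : fieldExtType rat) (k : nat)
    (e : 'I_k -> K) : Prop :=
  (forall i, is_unit (e i)) /\ \sum_(i < k) e i = 0.

Definition has_proper_vanishing_subsum (K : fieldExtType rat) (k : nat)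
    (e : 'I_k -> K) : Prop :=
  exists I : {set 'I_k},
    [/\ I != set0, I \proper [set: 'I_k] & \sum_(i in I) e i = 0].

Definition least (P : nat -> Prop) : \bar int :=
  match pselect (exists n, `[< P n >]) with
  | left exP => (Posz (ex_minn exP))%:E
  | right _ => +oo%E
  end.

Definition od (K : fieldExtType rat) : \bar int :=
  least (fun k => [/\ odd k, (3 <= k)%N &
    exists e : 'I_k -> K, unit_vanishing_sum e]).

Definition ev (K : fieldExtType rat) : \bar int :=
  least (fun k => [/\ ~~ odd k, (4 <= k)%N &
    exists e : 'I_k -> K,
      unit_vanishing_sum e /\ ~ has_proper_vanishing_subsum e]).

Definition ell (K : fieldExtType rat) : \bar int := Order.min (od K) (ev K).

(* R stands for the field of real numbers; embeddings are identified when they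
   agree pointwise. *)
Definition exactly_one_real_embedding (R : realType) (K : fieldExtType rat) :
    Prop :=
  exists s : {rmorphism K -> R}, forall t : {rmorphism K -> R}, t =1 s.

Definition complex_cubic (R : realType) (K : fieldExtType rat) : Prop :=
  \dim {:K} = 3%N /\ exactly_one_real_embedding R K.

(* Main.v *)
(* Take f = X^3 - A X^2 + B X - 1 with A + |B| + 2 = k, having one real root
   z > 1, and K = Q(z).  If every unit of K is +-z^j, then a vanishing sum of
   units is, up to a power of z, a nonzero multiple P of f in Z[X], and its
   length is at least the sum l1(P) of the absolute values of the coefficients.
   When A >= 3|B| + 6, the triangle inequality for P = Q f gives
   l1(P) >= l1(f) = k; when B = 0, one compares the leading term of P with the
   others at the real root z > A.  So l(K) = k as soon as z is not a proper
   power of a unit of K.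

   Suppose z = e^m.  Let a, b be the traces of e and 1/e; then A and B are the
   m-th power sums of the roots of X^3 - a X^2 + b X - 1 and of their inverses.
   - For B = 0, m = 2 forces k = 4 t^4 - 4 t + 2, and m = 3 is impossible mod 9.
     For k < 2^35 and m >= 5 there are finitely many (a, b, m), and checking
     them leaves only the 11th power of the root of X^3 - X^2 - 1, that is
     k = 69; there (A, B) = (55, -12) works.
   - For 2^l <= k < 2^(l+1) with l >= 35, let B run through 4 l + 4 numbers in a
     fixed class mod 36 that excludes m = 2 (mod 4) and m = 3 (mod 9).  If
     z = e^m then m < 4 l + 4, as a unit e > 1 satisfies e >= 5/4.  Each m >= 5
     excludes at most one B: two such e would be m-th roots of nearby large
     numbers, so extremely close, whereas distinct cubic units repel each other
     (a norm form in their traces is a nonzero integer).  So some B survives. *)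
Require Import Defs.
From HB Require Import structures.
From mathcomp Require Import all_boot all_order all_algebra all_field.
From mathcomp Require Import boolp reals constructive_ereal.
From mathcomp Require Import complex zify ring lra.
From Stdlib Require ZArith.

Set Implicit Arguments.
Unset Strict Implicit.
Unset Printing Implicit Defensive.

Import Order.TTheory GRing.Theory Num.Theory.

Local Open Scope ring_scope.

(** * Embeddings and traces *)

Lemma irreducible_root_dvdp (K : fieldExtType rat) (z : K) (f p : {poly rat}) :
  irreducible_poly f -> root (map_poly (in_alg K) f) z ->
  root (map_poly (in_alg K) p) z -> f %| p.
Proof.
move=> irr_f fz0; apply: contraTT; rewrite -(irreducible_poly_coprime _ irr_f) => cop.
have cop' : coprimep (map_poly (in_alg K) f) (map_poly (in_alg K) p).
  by rewrite coprimep_map.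
by rewrite rootE (coprimep_root cop' fz0).
Qed.

(** Send [p(z)] to [p(rho)]. This is well defined: two polynomials that agree at [z] differ by a
    multiple of [f], which vanishes at [rho]. *)
Lemma embedding_exists (K : fieldExtType rat) (z : K) (f : {poly rat})
    (F : numFieldType) (rho : F) :
  <<1; z>>%VS = fullv -> irreducible_poly f ->
  root (map_poly (in_alg K) f) z -> root (map_poly ratr f) rho ->
  exists t : {rmorphism K -> F}, t z = rho.
Proof.
move=> Kz irr_f fz0 frho0.
have repr x : exists p : {poly rat}, x == (map_poly (in_alg K) p).[z].
  have /Fadjoin1_polyP[p ->] : x \in <<1; z>>%VS by rewrite Kz memvf.
  by exists p.
pose q x := xchoose (repr x); have qE x : (map_poly (in_alg K) (q x)).[z] = x.
  by apply/esym/eqP; exact: (xchooseP (repr x)).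
pose ev p := (map_poly ratr p : {poly F}).[rho].
have evD : {morph ev : p p' / p - p'}.
  by move=> p p'; rewrite /ev rmorphB hornerD hornerN.
have evM : {morph ev : p p' / p * p'}.
  by move=> p p'; rewrite /ev rmorphM hornerM.
have wd p p' : (map_poly (in_alg K) p).[z] = (map_poly (in_alg K) p').[z] ->
    ev p = ev p'.
  move=> /eqP; rewrite -subr_eq0 -hornerN -hornerD -rmorphB => pp'0.
  have /dvdpP[d dE] : f %| p - p'.
    by apply: irreducible_root_dvdp irr_f fz0 _; apply/rootP/eqP.
  by apply/eqP; rewrite -subr_eq0 -evD dE evM /ev (eqP frho0) mulr0.
pose t x := ev (q x).
have tB : additive t.
  move=> x y; rewrite /t -evD; apply: wd.
  by rewrite rmorphB hornerD hornerN !qE.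
have tM : multiplicative t.
  split=> [x y|]; first by rewrite /t -evM; apply: wd; rewrite rmorphM hornerM !qE.
  rewrite /t (wd _ 1) ?/ev ?qE; last by rewrite rmorph1 hornerC.
  by rewrite rmorph1 hornerC.
pose tA := GRing.isAdditive.Build _ _ t tB.
pose tM' := GRing.isMultiplicative.Build _ _ t tM.
pose tR : {rmorphism K -> F} := HB.pack t tA tM'.
exists tR; rewrite /= /t (wd _ 'X) ?qE ?map_polyX ?hornerX //.
by rewrite /ev map_polyX hornerX.
Qed.

(** The monic equation descends to [rat], so [q] is a rational algebraic integer in [algC]. *)
Lemma rat_integral_int (F : numFieldType) (q : rat) :
  integralOver (intr : int -> F) (ratr q) -> exists m : int, q = m%:~R.
Proof.
case=> p pmon pq0.
have pq0' : root (map_poly (intr : int -> rat) p) q.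
  rewrite -(fmorph_root (ratr : rat -> F)) -map_poly_comp.
  by rewrite (eq_map_poly (g := intr)) // => x /=; rewrite ratr_int.
have : ratr q \in Aint.
  apply: (@root_monic_Aint (map_poly intr p)).
  - rewrite (eq_map_poly (g := ratr \o (intr : int -> rat))); last first.
      by move=> x /=; rewrite ratr_int.
    by rewrite map_poly_comp fmorph_root.
  - exact: monic_map.
  - by apply/polyOverP=> i; rewrite coef_map /= intr_int.
move/(Cint_rat_Aint (Crat_rat q)) => /intrP[m qm].
exists m; apply: (fmorph_inj (ratr : rat -> algC)).
by rewrite /= qm ratr_int.
Qed.

(* The sum of the n-th powers of the roots of X^3 - a X^2 + b X - 1. *)
Definition powsum (a b : int) (n : nat) : int :=
  (iter n (fun s => (s.1.2, s.2, a * s.2 - b * s.1.2 + s.1.1))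
     (3 : int, a, a ^+ 2 - 2 * b)).1.1.

(** Newton's recurrence; the iterated state holds three consecutive power sums. *)
Lemma powsumE (R : comPzRingType) (x y w : R) (a b : int) (n : nat) :
  x + y + w = a%:~R -> x * y + y * w + w * x = b%:~R -> x * y * w = 1 ->
  x ^+ n + y ^+ n + w ^+ n = (powsum a b n)%:~R.
Proof.
move=> e1 e2 e3; rewrite /powsum.
set st := fun s : int * int * int => _; pose p i := x ^+ i + y ^+ i + w ^+ i.
suff [e _ _] : [/\ p n = (iter n st (3 : int, a, a ^+ 2 - 2 * b)).1.1%:~R,
   p n.+1 = (iter n st (3 : int, a, a ^+ 2 - 2 * b)).1.2%:~R &
   p n.+2 = (iter n st (3 : int, a, a ^+ 2 - 2 * b)).2%:~R].
  exact: e.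
elim: n => [|n [IH0 IH1 IH2]] /=.
  rewrite /p !expr0 !expr1 e1 !(rmorphB, rmorphM, rmorphXn) /= -e1 -e2.
  by split => //; ring.
split=> //; rewrite !(rmorphB, rmorphM, rmorphD) /= -IH0 -IH1 -IH2 -e1 -e2.
by rewrite -[X in _ + X]mul1r -e3 /p !exprS; ring.
Qed.

Lemma is_integer_rmorph (K : fieldExtType rat) (F : fieldType)
    (g : {rmorphism K -> F}) (x : K) :
  is_integer x -> integralOver (intr : int -> F) (g x).
Proof.
move/(integral_rmorph g) => [p pm pr]; exists p => //.
by move: pr; rewrite (eq_map_poly (g := intr)) // => m /=; rewrite rmorph_int.
Qed.

Section Trace.
Variables (R : realType) (K : fieldExtType rat).
Variables (s : {rmorphism K -> R}) (t : {rmorphism K -> R[i]}).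

(* The trace is integral over Z, and rational because its values at the powers
   of z are; hence it is an integer. *)
Let cs x : R[i] := real_complex R (s x).
Let ct x : R[i] := conjc (t x).
Let tr x := cs x + t x + ct x.

Let trE x : tr x = real_complex R (s x + 2 * complex.Re (t x)).
Proof.
rewrite /tr /cs /ct; case: (t x) => p q; apply/eqP; rewrite eq_complex /=.
by apply/andP; split; apply/eqP; ring.
Qed.

Let rat_img (F : numFieldType) (g : {rmorphism K -> F}) q : g (in_alg K q) = ratr q.
Proof.
exact: (fmorph_eq_rat (g \o in_alg K) q).
Qed.

Variables (z : K) (A B : int).
Hypotheses (Kz : <<1; z>>%VS = fullv)
  (e1 : cs z + t z + ct z = A%:~R)
  (e2 : cs z * t z + t z * ct z + ct z * cs z = B%:~R)
  (e3 : cs z * t z * ct z = 1).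

Lemma trace_int x : is_integer x -> exists a : int, s x + 2 * complex.Re (t x) = a%:~R.
Proof.
have trat : exists q : rat, tr x = ratr q.
  have /Fadjoin1_polyP[p ->] : x \in <<1; z>>%VS by rewrite Kz memvf.
  exists (\sum_(i < size p) p`_i * (powsum A B i)%:~R).
  rewrite /tr /cs /ct !horner_coef !size_map_poly !rmorph_sum /= -!big_split /=.
  apply: eq_bigr => i _; rewrite !coef_map /= !rmorphM /= !rmorphXn /=.
  rewrite !(rat_img s, rat_img t) ratr_int -(powsumE i e1 e2 e3) /cs /ct.
  have -> (q : rat) : real_complex R (ratr q) = ratr q.
    exact: (fmorph_eq_rat (real_complex R \o ratr) q).
  have -> (q : rat) : conjc (ratr q : R[i]) = ratr q.
    exact: (fmorph_eq_rat (conjc \o ratr) q).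
  by ring.
move=> intx; case: trat => q trq.
have : integralOver (intr : int -> R[i]) (tr x).
  rewrite /tr; apply: integral_add; first apply: integral_add.
  - exact: (is_integer_rmorph (real_complex R \o s)).
  - exact: is_integer_rmorph.
  - exact: (is_integer_rmorph (conjc \o t)).
rewrite trq => /rat_integral_int[m qm]; exists m.
have := trE x; rewrite trq qm ratr_int -(rmorph_int (real_complex R)).
by move/(congr1 (@complex.Re R)).
Qed.

(** By Newton's identity, six times the norm is [a1^3 - 3 a1 a2 + 2 a3] in the traces of [x], [x^2],
    [x^3]. So the norm is rational, and it is integral as a product of conjugates. *)
Lemma norm_int x : is_integer x ->
  exists m : int, s x * (complex.Re (t x) ^+ 2 + complex.Im (t x) ^+ 2) = m%:~R.
Proof.
move=> intx.
have [a1 T1] := trace_int intx.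
have [a2 T2] := trace_int (integral_mul intx intx).
have [a3 T3] := trace_int (integral_mul intx (integral_mul intx intx)).
have NE : cs x * t x * ct x = real_complex R
    (s x * (complex.Re (t x) ^+ 2 + complex.Im (t x) ^+ 2)).
  rewrite /cs /ct; case: (t x) => p q; apply/eqP; rewrite eq_complex /=.
  by apply/andP; split; apply/eqP; ring.
have : integralOver (intr : int -> R[i]) (cs x * t x * ct x).
  apply: integral_mul; first apply: integral_mul.
  - exact: (is_integer_rmorph (real_complex R \o s)).
  - exact: is_integer_rmorph.
  - exact: (is_integer_rmorph (conjc \o t)).
have Nrat : cs x * t x * ct x =
    ratr ((a1 ^+ 3 - 3 * a1 * a2 + 2 * a3)%:~R / 6%:~R).
  rewrite fmorph_div /= !ratr_int.
  have -> : (a1 ^+ 3 - 3 * a1 * a2 + 2 * a3)%:~R = 6%:~R * (cs x * t x * ct x).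
    have trC y m : s y + 2 * complex.Re (t y) = m%:~R -> m%:~R = tr y.
      by rewrite trE => ->; rewrite rmorph_int.
    rewrite !(rmorphB, rmorphM, rmorphD, rmorphXn) /=.
    rewrite (trC _ _ T1) (trC _ _ T2) (trC _ _ T3) /tr /cs /ct !rmorphM /=.
    by ring.
  by rewrite [RHS]mulrC mulKf // intr_eq0.
rewrite {1}Nrat => /rat_integral_int[m qm]; exists m.
move: NE; rewrite Nrat qm ratr_int -(rmorph_int (real_complex R)).
by move/(congr1 (@complex.Re R)).
Qed.

End Trace.

(** * Units of a complex cubic field *)

(* X^3 - a X^2 + b X - 1 = (X - u) (X^2 - w X + 1/u), where the quadratic factor
   has discriminant <= 0. *)
Definition root_data (R : realType) (a b : int) (u w : R) : Prop :=
  [/\ 1 < u, u + w = a%:~R, u * w + u^-1 = b%:~R & w ^+ 2 * u <= 4].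

(* The real data left when the unit of traces A, B is the m-th power of a unit. *)
Definition unit_power (R : realType) (A B : int) (m : nat) : Prop :=
  exists a b : int, exists u w : R,
    [/\ root_data a b u w, powsum a b m = A, powsum b a m = B &
        `|u ^+ m - A%:~R| <= 2].

Section RootData.
Variables (R : realType) (a b : int) (u w : R).
Hypothesis dat : root_data a b u w.

Lemma root_data_norm_bounds : `|w| < 2 /\ (u * w) ^+ 2 <= 4 * u.
Proof.
case: dat => u1 _ _ w4; split; last first.
  have : 0 <= u * (4 - w ^+ 2 * u) by apply: mulr_ge0; lra.
  by rewrite exprMn; nra.
have : w ^+ 2 < 2 ^+ 2.
  have : 0 <= w ^+ 2 * (u - 1) by apply: mulr_ge0; rewrite ?sqr_ge0 //; lra.
  have [/eqP|w0] := eqVneq (w ^+ 2) 0; first by move=> /eqP ->; lra.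
  have : 0 < w ^+ 2 * (u - 1) by apply: mulr_gt0; rewrite ?lt0r ?w0 ?sqr_ge0 //; lra.
  by lra.
by rewrite -[X in X < _](real_normK (num_real w)) ltr_sqr ?nnegrE.
Qed.

(** This is minus the value of the cubic at 1, computed from its factorization; the next lemma does
    the same at -1. *)
Lemma root_data_eval1 : (a - b)%:~R = (u - 1) * (1 - w + u^-1).
Proof.
case: dat => u1 e1 e2 _; rewrite rmorphB /= -e1 -e2; field.
by apply/eqP; lra.
Qed.

Lemma root_data_evalN1 : (a + b + 2)%:~R = (u + 1) * (1 + w + u^-1).
Proof.
case: dat => u1 e1 e2 _; rewrite !rmorphD /= -e1 -e2; field.
by apply/eqP; lra.
Qed.

(** Values of the quadratic factor at 1 and -1. After multiplication by [u] the claim is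
    [|u w| < u + 1], which follows from [(u w)^2 <= 4 u < (u + 1)^2]. *)
Lemma root_data_quad_gt0 : 0 < 1 - w + u^-1 /\ 0 < 1 + w + u^-1.
Proof.
case: dat => u1 _ _ _; have [_ uw4] := root_data_norm_bounds.
have u0 : 0 < u by lra.
have E : u * u^-1 = 1 by rewrite mulfV //; apply/eqP; lra.
have uw : `|u * w| < u + 1.
  have sq : (u * w) ^+ 2 < (u + 1) ^+ 2 by nra.
  rewrite -(ger0_norm (_ : 0 <= u + 1)); last by lra.
  by rewrite -ltr_sqr ?nnegrE // -!normrX !ger0_norm ?sqr_ge0.
have [uw1 uw2] : - (u + 1) < u * w /\ u * w < u + 1.
  by apply/andP; rewrite -ltr_norml.
by split; rewrite -(pmulr_rgt0 _ u0); nra.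
Qed.

Lemma root_data_lt : b < a /\ - 2 < a + b.
Proof.
have [p1 p2] := root_data_quad_gt0; case: dat => u1 _ _ _.
have := root_data_eval1; have := root_data_evalN1 => h1 h2.
split; first by rewrite -subr_gt0 -(ltr0z R) h2 mulr_gt0 // subr_gt0.
have : 0 < a + b + 2 by rewrite -(ltr0z R) h1 mulr_gt0 //; lra.
by lia.
Qed.

(** The positive integer [a - b] is at least 1 and equals [(u - 1) (1 - w + 1/u)], whose second
    factor is below [1 + 2 + 1]. *)
Lemma root_data_gap : 5 / 4 <= u.
Proof.
have [p1 p2] := root_data_quad_gt0; case: dat => u1 _ _ _.
have [w2 _] := root_data_norm_bounds.
have h := root_data_eval1; have [ba _] := root_data_lt.
have : (1 : R) <= (a - b)%:~R by rewrite -(mulr1z 1) ler_int; lia.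
have ui : u^-1 < 1 by rewrite invf_lt1 //; lra.
move: w2; rewrite ltr_norml => /andP[w2 _].
rewrite h => h1; nra.
Qed.

End RootData.

Section IntegerUnits.
Variable K : fieldExtType rat.
Implicit Types x y : K.

Lemma is_unitP x :
  is_unit x <-> [/\ x != 0, is_integer x & is_integer x^-1].
Proof.
split=> [[ix [y iy xy]]|[x0 ix iy]]; last by split=> //; exists x^-1; rewrite ?divff.
have x0 : x != 0 by apply: contra_eq_neq xy => ->; rewrite mul0r eq_sym oner_eq0.
by split=> //; rewrite -[x^-1]mulr1 -xy mulKf.
Qed.

Lemma is_unitM x y : is_unit x -> is_unit y -> is_unit (x * y).
Proof.
move=> /is_unitP[x0 ix jx] /is_unitP[y0 iy jy]; apply/is_unitP; split.
- by rewrite mulf_neq0.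
- exact: integral_mul.
- by rewrite invfM; apply: integral_mul.
Qed.

Lemma is_unitV x : is_unit x -> is_unit x^-1.
Proof.
by move=> /is_unitP[x0 ix jx]; apply/is_unitP; rewrite invrK invr_eq0.
Qed.

Lemma is_unitN x : is_unit x -> is_unit (- x).
Proof.
move=> /is_unitP[x0 ix jx]; apply/is_unitP; rewrite oppr_eq0 invrN.
by split=> //; apply: integral_opp.
Qed.

Lemma is_unit1 : is_unit (1 : K).
Proof.
by apply/is_unitP; split; rewrite ?oner_eq0 ?invr1 //; apply: integral1.
Qed.

Lemma is_unitX x n : is_unit x -> is_unit (x ^+ n).
Proof.
move=> ux; elim: n => [|n IH]; first by rewrite expr0; apply: is_unit1.
by rewrite exprS; apply: is_unitM.
Qed.

End IntegerUnits.

(** * The unit group of the cubic field *)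

Section UnitGroup.
Variables (R : realType) (K : fieldExtType rat).
Variables (s : {rmorphism K -> R}) (t : {rmorphism K -> R[i]}).
Variables (z : K) (A B : int).
Hypotheses (Kz : <<1; z>>%VS = fullv)
  (e1 : real_complex R (s z) + t z + conjc (t z) = A%:~R)
  (e2 : real_complex R (s z) * t z + t z * conjc (t z) +
        conjc (t z) * real_complex R (s z) = B%:~R)
  (e3 : real_complex R (s z) * t z * conjc (t z) = 1).

Let re x := 2 * complex.Re (t x).

Let tr_ x : real_complex R (s x) + t x + conjc (t x) = real_complex R (s x + re x).
Proof.
rewrite /re; case: (t x) => p q; apply/eqP; rewrite eq_complex /=.
by apply/andP; split; apply/eqP; ring.
Qed.

(** A unit with [s x > 0] has norm 1, so its conjugates are the roots of [X^3 - a X^2 + b X - 1],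
    where [b] is the trace of [1/x]. *)
Lemma unit_data x : is_unit x -> 0 < s x -> exists a b : int,
  [/\ s x + re x = a%:~R, s x * re x + (s x)^-1 = b%:~R,
   re x ^+ 2 * s x <= 4 &
   forall n, s (x ^+ n) + re (x ^+ n) = (powsum a b n)%:~R /\
             s (x ^+ n)^-1 + re (x ^+ n)^-1 = (powsum b a n)%:~R].
Proof.
move=> ux sx0; have /is_unitP[x0 ix jx] := ux.
pose N y := s y * (complex.Re (t y) ^+ 2 + complex.Im (t y) ^+ 2).
have NE y : real_complex R (s y) * t y * conjc (t y) = real_complex R (N y).
  rewrite /N; case: (t y) => p q; apply/eqP; rewrite eq_complex /=.
  by apply/andP; split; apply/eqP; ring.
have NM : N x * N x^-1 = 1.
  have : real_complex R (N x * N x^-1) = 1.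
    rewrite rmorphM /= -!NE.
    transitivity (real_complex R (s (x / x)) * t (x / x) * conjc (t (x / x))).
      by rewrite !rmorphM /=; ring.
    by rewrite divff // !rmorph1 !mulr1.
  by move/(congr1 (@complex.Re R)).
(* The norm is a nonnegative integer with an integer inverse. *)
have N1 : N x = 1.
  have [m Nm] := norm_int Kz e1 e2 e3 ix; have [n Nn] := norm_int Kz e1 e2 e3 jx.
  have N0 : 0 <= N x by rewrite /N mulr_ge0 ?addr_ge0 ?sqr_ge0 // ltW.
  have mn : m * n = 1.
    by apply: (@intr_inj R); rewrite rmorphM /= -Nm -Nn; apply: NM.
  have m0 : 0 <= m by rewrite -(ler0z R) -Nm.
  have /eqP : (`|m| * `|n|)%N = 1%N by rewrite -abszM mn.
  rewrite muln_eq1 => /andP[/eqP m1 _].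
  by rewrite /N Nm -(gez0_abs m0) m1.
have [a Ta] := trace_int Kz e1 e2 e3 ix; have [b Tb] := trace_int Kz e1 e2 e3 jx.
pose X := real_complex R (s x); pose Y := t x; pose W := conjc (t x).
have E3 : X * Y * W = 1 by rewrite NE N1 rmorph1.
have E1 : X + Y + W = a%:~R by rewrite tr_ Ta rmorph_int.
have X0 : X != 0 by rewrite fmorph_eq0 gt_eqF.
have XV : X^-1 = Y * W by rewrite -[X^-1]mulr1 -E3 -mulrA mulKf.
have Y0 : Y != 0 by rewrite fmorph_eq0.
have W0 : W != 0 by rewrite !fmorph_eq0.
have YV : Y^-1 = W * X.
  by rewrite -[Y^-1]mulr1 -E3 mulrAC -mulrA mulrC mulrA mulfK // mulrC.
have WV : W^-1 = X * Y by rewrite -[W^-1]mulr1 -E3 mulrC mulfK.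
have E2' : X^-1 + Y^-1 + W^-1 = b%:~R.
  have := tr_ x^-1; rewrite [in RHS]/re Tb rmorph_int => <-.
  by rewrite /X /Y /W !fmorphV.
have E2 : X * Y + Y * W + W * X = b%:~R by rewrite -E2' XV YV WV; ring.
exists a, b; split => //.
- have -> : s x * re x + (s x)^-1 = s x^-1 + re x^-1.
    have : real_complex R (s x * re x + (s x)^-1) = real_complex R (s x^-1 + re x^-1).
      rewrite -tr_ !fmorphV /= -/X -/Y -/W XV YV WV rmorphD fmorphV /= -/X XV.
      rewrite rmorphM /= -/X.
      have -> : real_complex R (re x) = Y + W.
        by apply: (addrI X); rewrite addrA tr_ rmorphD.
      by ring.
    by move/(congr1 (@complex.Re R)).
  exact: Tb.
- have : re x ^+ 2 * s x <= 4 * N x; last by rewrite N1 mulr1.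
  rewrite /re /N; set p := complex.Re _; set q := complex.Im _.
  have : 0 <= s x * q ^+ 2 by rewrite mulr_ge0 ?sqr_ge0 // ltW.
  by lra.
- move=> n; split.
    have := powsumE n E1 E2 E3; rewrite /X /Y /W -!rmorphXn /= tr_.
    rewrite -(rmorph_int (real_complex R)).
    by move/(congr1 (@complex.Re R)).
  have := @powsumE _ X^-1 Y^-1 W^-1 b a n E2'.
  have -> : X^-1 * Y^-1 + Y^-1 * W^-1 + W^-1 * X^-1 = a%:~R.
    by rewrite XV YV WV -E1 -[RHS]mul1r -E3; ring.
  have -> : X^-1 * Y^-1 * W^-1 = 1 by rewrite -!invfM E3 invr1.
  move=> /(_ erefl erefl); rewrite /X /Y /W -!fmorphV -!rmorphXn /= tr_ exprVn.
  rewrite -(rmorph_int (real_complex R)).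
  by move/(congr1 (@complex.Re R)).
Qed.

Lemma unit_root_data x : is_unit x -> 1 < s x -> exists a b : int,
  root_data a b (s x) (2 * complex.Re (t x)) /\
  forall n, s (x ^+ n) + 2 * complex.Re (t (x ^+ n)) = (powsum a b n)%:~R /\
    s (x ^+ n)^-1 + 2 * complex.Re (t (x ^+ n)^-1) = (powsum b a n)%:~R.
Proof.
move=> ux sx1; have sx0 : 0 < s x by lra.
have [a [b [h1 h2 h3 h4]]] := unit_data ux sx0.
by exists a, b.
Qed.

Lemma unit_gap x : is_unit x -> 1 < s x -> 5 / 4 <= s x.
Proof.
by move=> ux /(unit_root_data ux)[a [b [/root_data_gap]]].
Qed.

Lemma exists_exp_gt (y : R) : exists n : nat, y < (5 / 4) ^+ n.
Proof.
have [y0 | y0] := lerP y 0; first by exists 0%N; rewrite expr0; lra.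
(* Since [(5/4)^4 = 625/256 > 2], four more factors at least double the power. *)
exists (4 * Num.truncn y).+1.
have h := truncnS_gt y; apply: (lt_le_trans h).
have : forall n, n.+1%:R <= (5 / 4 : R) ^+ (4 * n).+1.
  elim=> [|n IH]; first by rewrite muln0 expr1; lra.
  rewrite -natr1 mulnS -addnS exprD.
  have : 1 <= n.+1%:R :> R by rewrite ler1n.
  have -> : (5 / 4 : R) ^+ 4 = 625 / 256 by field.
  by nra.
by apply.
Qed.

(** Descent: if a unit [x] satisfies [1 < s x < s y], then [y / x] is a unit above 1, so
    [s x <= (4/5) s y] by [unit_gap], and the exponent [n] drops. *)
Lemma fundamental_unit_exists : is_unit z -> 1 < s z ->
  exists e, [/\ is_unit e, 1 < s e & forall x, is_unit x -> 1 < s x -> s e <= s x].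
Proof.
move=> uz sz1; have [n zn] := exists_exp_gt (s z).
suff min_below y : is_unit y -> 1 < s y -> s y < (5 / 4) ^+ n -> exists e,
    [/\ is_unit e, 1 < s e & forall x, is_unit x -> 1 < s x -> s e <= s x].
  exact: (min_below z).
elim: n y {zn} => [|n IH] y uy sy1 yn.
  by move: yn; rewrite expr0; lra.
have [[x [ux x1 xy]]|nex] := pselect (exists x, [/\ is_unit x, 1 < s x & s x < s y]).
  apply: (IH x) => //.
  have g : 5 / 4 <= s (y / x).
    apply: unit_gap; first by apply: is_unitM => //; apply: is_unitV.
    by rewrite fmorph_div ltr_pdivlMr ?mul1r //; lra.
  move: g yn; rewrite fmorph_div ler_pdivlMr; last by lra.
  by rewrite exprS; nra.
exists y; split=> // x ux x1; rewrite leNgt; apply/negP => xy.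
by apply: nex; exists x.
Qed.

(** Divide by [e] until the value 1 is reached; injectivity of [s] then gives the unit 1. *)
Lemma fundamental_unit_power e : is_unit e -> 1 < s e ->
  (forall x, is_unit x -> 1 < s x -> s e <= s x) ->
  forall x, is_unit x -> 1 <= s x -> exists n, x = e ^+ n.
Proof.
move=> ue se1 min_e x ux sx1; have [n] := exists_exp_gt (s x).
have e5 := unit_gap ue se1; have e0 : e != 0 by have /is_unitP[] := ue.
elim: n x ux sx1 => [|n IH] x ux x1 xn; first by move: xn; rewrite expr0; lra.
move: x1; rewrite le_eqVlt => /orP[/eqP x1|x1].
  by exists 0%N; apply: (fmorph_inj s); rewrite -x1 expr0 rmorph1.
have ex := min_e x ux x1.
have [||| m xm] := IH (x / e).
- by apply: is_unitM => //; apply: is_unitV.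
- by rewrite fmorph_div ler_pdivlMr ?mul1r //; lra.
- rewrite fmorph_div ltr_pdivrMr; last by lra.
  move: xn; rewrite exprS; have : 0 < (5 / 4 : R) ^+ n by rewrite exprn_gt0 //; lra.
  by nra.
by exists m.+1; rewrite exprSr -xm divfK.
Qed.

(** The difference is twice the real part of [t z], and [|t z|^2 = 1 / s z < 1]. *)
Lemma norm_re_le2 : 1 < s z -> `|s z - A%:~R| <= 2.
Proof.
move: (t z) e1 e3 => [p q] h1 h3 sz1.
have {h1} <- : s z + 2 * p = A%:~R.
  move: h1; rewrite -(rmorph_int (real_complex R)) => /(congr1 (@complex.Re R)) /= <-.
  by ring.
have h : s z * (p ^+ 2 + q ^+ 2) = 1.
  by move/(congr1 (@complex.Re R)): h3 => /= <-; ring.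
have : p ^+ 2 <= 1.
  have : 0 <= (s z - 1) * p ^+ 2 by rewrite mulr_ge0 ?sqr_ge0 //; lra.
  have : 0 <= s z * q ^+ 2 by rewrite mulr_ge0 ?sqr_ge0 //; lra.
  by lra.
rewrite -[X in _ <= X](expr1n _ 2) -(real_normK (num_real p)) ler_sqr ?nnegrE //.
have -> : s z - (s z + 2 * p) = - (2 * p) by ring.
by move=> p1; rewrite normrN normrM (ger0_norm (ler0n _ 2)); lra.
Qed.

(** Write [z = e^m] with [e] fundamental. The listed exponents suffice: an [m >= 2] divisible by
    neither 2 nor 3 is at least 5. Hence [m = 1]. *)
Lemma unit_group : is_unit z -> 1 < s z ->
  (forall m, (m == 2) || (m == 3) || (5 <= m)%N -> ~ unit_power R A B m) ->
  forall x, is_unit x -> exists (b : bool) (j : int), x = (-1) ^+ b * z ^ j.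
Proof.
move=> uz sz1 npow.
have [e [ue e1' min_e]] := fundamental_unit_exists uz sz1.
have pow_e := fundamental_unit_power ue e1' min_e.
have [m zm] := pow_e z uz (ltW sz1).
have m0 : (0 < m)%N by case: m zm sz1 => // ->; rewrite expr0 rmorph1 ltxx.
have e0 : e != 0 by have /is_unitP[] := ue.
(* If [m = d m'], then [z] is the [m']-th power of the unit [e^d]. *)
have kill d m' : (0 < d)%N -> m = (d * m')%N -> unit_power R A B m'.
  move=> d0 md; have zE : z = (e ^+ d) ^+ m' by rewrite -exprM -md.
  have ued := is_unitX d ue.
  have sed : 1 < s (e ^+ d) by rewrite rmorphXn exprn_egt1 // -lt0n.
  have [a [b [dat hp]]] := unit_root_data ued sed.
  have [p1 p2] := hp m'; rewrite -zE in p1 p2.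
  have zc y (n : int) : s y + 2 * complex.Re (t y) = n%:~R ->
      real_complex R (s y) + t y + conjc (t y) = n%:~R.
    rewrite -(rmorph_int (real_complex R)) => <-.
    case: (t y) => p q; apply/eqP; rewrite eq_complex /=.
    by apply/andP; split; apply/eqP; ring.
  exists a, b, (s (e ^+ d)), (2 * complex.Re (t (e ^+ d))); split=> //.
  - by apply: (@intr_inj R[i]); rewrite -(zc _ _ p1).
  - apply: (@intr_inj R[i]); rewrite -(zc _ _ p2) -e2 !fmorphV /=.
    set X := real_complex R (s z); set Y := t z; set W := conjc (t z).
    have E3 : X * Y * W = 1 by [].
    have X0 : X != 0 by rewrite fmorph_eq0 gt_eqF //; lra.
    have Y0 : Y != 0.
      by apply: contra_eq_neq E3 => ->; rewrite mulr0 mul0r eq_sym oner_eq0.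
    have W0 : W != 0 by rewrite fmorph_eq0.
    (* As the norm is 1, the sum of the inverses of the conjugates is their second symmetric
       function. *)
    apply: (mulfI (mulf_neq0 (mulf_neq0 X0 Y0) W0)).
    rewrite [in RHS]E3 mul1r; field.
    by rewrite X0 Y0 W0.
  - by rewrite -rmorphXn -zE norm_re_le2.
have m1 : m = 1%N.
  apply/eqP; rewrite eqn_leq m0 andbT leqNgt; apply/negP => m2.
  have [m2' | nm2] := boolP (2 %| m)%N.
    apply: (npow 2%N) => //; apply: (kill (m %/ 2)%N); last by rewrite divnK.
    by rewrite divn_gt0.
  have [m3' | nm3] := boolP (3 %| m)%N.
    apply: (npow 3%N) => //; apply: (kill (m %/ 3)%N); last by rewrite divnK.
    by rewrite divn_gt0 // dvdn_leq.
  apply: (npow m); last by apply: (kill 1%N); rewrite ?mul1n.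
  by case: m m2 nm2 nm3 {zm m0 kill} => [|[|[|[|[|m]]]]].
rewrite {}m1 expr1 in zm.
have pos x : is_unit x -> 0 < s x -> exists j : int, x = z ^ j.
  move=> ux x0; have [x1|x1] := lerP 1 (s x).
    have [n ->] := pow_e x ux x1; exists n; by rewrite zm.
  have [||n xn] := pow_e x^-1; first exact: is_unitV.
    by rewrite fmorphV invf_ge1 // ltW.
  by exists (- (n : int)); rewrite -[LHS]invrK xn zm -exprnN.
move=> x ux; have sx0 : s x != 0 by rewrite fmorph_eq0; have /is_unitP[] := ux.
have [x0|x0|x0] := ltrgt0P (s x).
- by have [j ->] := pos x ux x0; exists false, j; rewrite mul1r.
- have [||j xj] := pos (- x); first exact: is_unitN.
    by rewrite rmorphN oppr_gt0.
  by exists true, j; rewrite expr1 mulN1r -xj opprK.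
- by rewrite x0 eqxx in sx0.
Qed.

End UnitGroup.

(** * Lengths of multiples of the cubic *)

Definition l1 (p : {poly int}) : nat := (\sum_(i < size p) absz (p`_i)%R)%N.

Lemma l1E (p : {poly int}) n :
  (size p <= n)%N -> l1 p = (\sum_(i < n) absz (p`_i)%R)%N.
Proof.
move=> pn; rewrite /l1 (big_ord_widen n (fun i => absz p`_i) pn).
rewrite [RHS](bigID (fun i : 'I_n => (i < size p)%N)) /= [X in (_ + X)%N]big1 ?addn0 //.
by move=> i; rewrite -leqNgt => /(nth_default 0) ->.
Qed.

Lemma l1D p q : (l1 (p + q) <= l1 p + l1 q)%N.
Proof.
pose n := maxn (size p) (size q).
rewrite (@l1E (p + q) n) ?size_polyD // (@l1E p n) ?leq_maxl //.
rewrite (@l1E q n) ?leq_maxr // -big_split /=.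
by apply: leq_sum => i _; rewrite coefD -lez_nat PoszD !abszE ler_normD.
Qed.

Lemma l1Z c p : l1 (c *: p) = (`|c| * l1 p)%N.
Proof.
rewrite (@l1E _ (size p)) ?size_scale_leq // /l1 big_distrr /=.
by apply: eq_bigr => i _; rewrite coefZ abszM.
Qed.

Lemma l1N p : l1 (- p) = l1 p.
Proof. by rewrite -scaleN1r l1Z mul1n. Qed.

Lemma l1MXn p n : l1 (p * 'X^n) = l1 p.
Proof.
elim: n => [|n <-]; first by rewrite mulr1.
rewrite exprSr mulrA; set q := p * _.
rewrite (@l1E (q * 'X) (size q).+1); last first.
  by rewrite (leq_trans (size_polyMleq _ _)) // size_polyX addn2.
rewrite big_ord_recl coefMX /= add0n /l1.
by apply: eq_bigr => i _; rewrite coefMX.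
Qed.

Lemma l1_sum (I : finType) (P : pred I) (F : I -> {poly int}) :
  (l1 (\sum_(i | P i) F i)%R <= \sum_(i | P i) l1 (F i))%N.
Proof.
elim/big_ind2: _ => // [|p m q n pm qn]; first by rewrite /l1 size_poly0 big_ord0.
by rewrite (leq_trans (l1D _ _)) // leq_add.
Qed.

Lemma l1_recr p : p != 0 ->
  l1 p = (\sum_(i < (size p).-1) absz (p`_i)%R + `|lead_coef p|)%N.
Proof.
by move=> p0; rewrite (@l1E p (size p).-1.+1) ?leqSpred // big_ord_recr.
Qed.

Lemma l1_gt0 p : p != 0 -> (0 < l1 p)%N.
Proof.
move=> p0; rewrite l1_recr // addn_gt0 absz_gt0 lead_coef_eq0 p0 orbT //.
Qed.

Lemma l1_eq1 p : l1 p = 1%N -> exists c i, p = c *: 'X^i /\ `|c|%N = 1%N.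
Proof.
move=> p1; have p0 : p != 0.
  by apply: contra_eq_neq p1 => ->; rewrite /l1 size_poly0 big_ord0.
exists (lead_coef p), (size p).-1.
have l0 : (0 < `|lead_coef p|)%N by rewrite absz_gt0 lead_coef_eq0.
have [/eqP low0 lead1] : (\sum_(i < (size p).-1) absz (p`_i)%R)%N == 0%N /\
    `|lead_coef p|%N = 1%N.
  by move: p1; rewrite l1_recr //; lia.
split=> //; apply/polyP => i; rewrite coefZ coefXn.
have [->|ni] := eqVneq i (size p).-1; first by rewrite mulr1 lead_coefE.
rewrite mulr0; have [ip|pi] := ltnP i (size p).-1.
  move/eqP: low0; rewrite sum_nat_eq0 => /forallP /(_ (Ordinal ip)) /=.
  by rewrite absz_eq0 => /eqP.
rewrite nth_default //; move: p0; rewrite -size_poly_gt0 => p0.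
by rewrite -(prednK p0) ltn_neqAle eq_sym ni.
Qed.

Definition cubic (A B : int) : {poly int} := 'X^3 - A *: 'X^2 + B *: 'X - 1.

Lemma size_cubic A B : size (cubic A B) = 4%N.
Proof.
rewrite /cubic -!addrA size_polyDl size_polyXn //.
apply: (leq_ltn_trans (size_polyD _ _)); rewrite gtn_max size_polyN.
rewrite (leq_ltn_trans (size_scale_leq _ _)) ?size_polyXn //=.
apply: (leq_ltn_trans (size_polyD _ _)); rewrite gtn_max size_polyN.
by rewrite (leq_ltn_trans (size_scale_leq _ _)) ?size_polyX ?size_poly1.
Qed.

Lemma coef_cubic A B i :
  (cubic A B)`_i = [:: -1; B; - A; 1]`_i.
Proof.
rewrite /cubic !(coefB, coefD, coefZ, coefXn, coefX, coef1).
case: i => [|[|[|[|i]]]] //=.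
all: by rewrite ?nth_nil ?mulr0 ?mulr1 ?addr0 ?sub0r ?subr0 ?add0r.
Qed.

Lemma monic_cubic A B : cubic A B \is monic.
Proof. by rewrite monicE lead_coefE size_cubic coef_cubic. Qed.

Lemma l1_cubic A B : l1 (cubic A B) = (`|A| + `|B| + 2)%N.
Proof.
rewrite /l1 size_cubic !big_ord_recr big_ord0 /= !coef_cubic /= ?abszN; lia.
Qed.

(* If l1 q = 1 then q is a signed monomial; otherwise l1 q >= 2 and the
   coefficient A dominates. *)
Lemma l1_cubic_mul A B (q : {poly int}) :
  3 * `|B| + 6 <= A -> q != 0 -> (`|A| + `|B| + 2 <= l1 (q * cubic A B))%N.
Proof.
move=> AB q0; have := l1_gt0 q0; rewrite leq_eqVlt => /orP[/eqP/esym|q2].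
  move=> /l1_eq1[c [i [-> c1]]].
  by rewrite -scalerAl mulrC l1Z c1 mul1n l1MXn l1_cubic.
have : (`|A| * l1 q <= (2 + `|B|) * l1 q + l1 (q * cubic A B))%N.
  have {1}-> : (`|A| * l1 q = l1 (A *: (q * 'X^2)))%N by rewrite l1Z l1MXn.
  (* Solve [q f] for its term [A q X^2] and apply the triangle inequality. *)
  have -> : A *: (q * 'X^2) =
      q * 'X^3 + (B *: (q * 'X^1) + (- q + - (q * cubic A B))).
    by rewrite /cubic -!mul_polyC expr1; ring.
  rewrite (leq_trans (l1D _ _)) // l1MXn (leq_trans (leq_add (leqnn _) (l1D _ _))) //.
  rewrite l1Z l1MXn (leq_trans (leq_add (leqnn _) (leq_add (leqnn _) (l1D _ _)))) //.
  by rewrite !l1N; lia.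
have ab : (3 * `|B| + 6 <= `|A|)%N by move: AB; lia.
move: (l1 (q * _)) (l1 q) q2 `|A|%N `|B|%N ab => L l l2 a b ab h.
(* With [l1 q >= 2] the product has length at least [2 (A - 2 - |B|)], which is at least
   [A + |B| + 2] when [A >= 3 |B| + 6]. *)
by nia.
Qed.

(** At the root [th] the leading term is balanced by the lower ones, so the sum [S] of their
    absolute coefficients is at least [th > A]. Thus [S >= A + 1], and the leading coefficient adds
    at least 1. *)
Lemma l1_root_ge (R : realType) (A : nat) (th : R) (p : {poly int}) :
  A%:R < th -> 1 <= th -> p != 0 -> (map_poly intr p).[th] = 0 ->
  (A + 2 <= l1 p)%N.
Proof.
move=> Ath th1 p0.
have [d dE] : exists d, size p = d.+1.
  by exists (size p).-1; rewrite prednK // size_poly_gt0.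
have lc0 : (0 < `|lead_coef p|)%N by rewrite absz_gt0 lead_coef_eq0.
rewrite (@l1_recr p p0) dE /= horner_coef size_map_poly_id0; last first.
  by rewrite intr_eq0 lead_coef_eq0.
rewrite dE big_ord_recr /= !coef_map /=.
have -> : p`_d = lead_coef p by rewrite lead_coefE dE.
set l := lead_coef p in lc0 *; set S := (\sum_(i < d) _)%N => h.
have habs (c : int) : `|c%:~R| = (`|c|%N)%:R :> R by rewrite -intr_norm pmulrn abszE.
have th0 : 0 < th by lra.
case: d dE @S h => [|d] dE S h.
  move: h; rewrite big_ord0 add0r expr0 mulr1 => /eqP; rewrite intr_eq0 => /eqP l0.
  by move: lc0; rewrite l0.
have : `|l|%:R * th ^+ d.+1 <= S%:R * th ^+ d.
  have /eqP := h; rewrite addrC addr_eq0 => /eqP/(congr1 Num.norm).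
  rewrite normrN normrM habs [X in _ * X]ger0_norm ?exprn_ge0 ?(ltW th0) // => ->.
  apply: (le_trans (ler_norm_sum _ _ _)); rewrite /S natr_sum mulr_suml.
  apply: ler_sum => i _; rewrite coef_map /= normrM habs ler_wpM2l //.
  by rewrite ger0_norm ?exprn_ge0 ?(ltW th0) // ler_weXn2l // -ltnS.
rewrite exprS mulrA ler_pM2r ?exprn_gt0 // => hS.
have : (A < S)%N.
  have : A%:R < S%:R :> R.
    apply: (lt_le_trans Ath); apply: le_trans hS.
    by rewrite ler_peMl ?(ltW th0) // ler1n.
  by rewrite ltr_nat.
lia.
Qed.

(** * Distinct cubic units repel each other *)

Lemma horner_cubic (R : comNzRingType) (A B : int) (x : R) :
  (map_poly intr (cubic A B)).[x] = x ^+ 3 - A%:~R * x ^+ 2 + B%:~R * x - 1.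
Proof.
rewrite /cubic !(rmorphB, rmorphD) /= !map_polyZ !map_polyXn map_polyX rmorph1.
by rewrite !hornerE.
Qed.

(** A rational root is an integer dividing 1, and the values at 1 and -1 are [B - A] and
    [-(A + B + 2)]. *)
Lemma cubic_root_rat (A B : int) (q : rat) :
  B != A -> A + B != -2 -> ~~ root (map_poly intr (cubic A B)) q.
Proof.
move=> BA AB; apply/negP => rq.
have [m qm] : exists m : int, q = m%:~R.
  apply: (@rat_integral_int algC); exists (cubic A B); first exact: monic_cubic.
  rewrite (eq_map_poly (g := ratr \o (intr : int -> rat))).
    by rewrite map_poly_comp fmorph_root.
  by move=> x /=; rewrite ratr_int.
move: rq; rewrite qm /root horner_cubic -!rmorphXn -!rmorphM -!rmorphB -rmorphD.
rewrite -(rmorph1 (intr : int -> rat)) -rmorphB intr_eq0 => /eqP h.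
have /eqP : (absz m * absz (m ^+ 2 - A * m + B)%R)%N = 1%N.
  rewrite -abszM; set v := m * _.
  by have -> : v = m ^+ 3 - A * m ^+ 2 + B * m - 1 + 1; [rewrite /v; ring | rewrite h].
rewrite muln_eq1 => /andP[/eqP m1 _].
have [mE|mE] : m = 1 \/ m = -1 by lia.
  by move: h BA; rewrite mE expr1n; lia.
by move: h AB; rewrite mE; lia.
Qed.

(** The form is [x^3 f(y/x)], the norm of [y - u x]; a zero would be a rational root of [f]. *)
Lemma norm_form_neq0 (a b x y : int) :
  b != a -> a + b != -2 -> x != 0 ->
  y ^+ 3 - a * y ^+ 2 * x + b * y * x ^+ 2 - x ^+ 3 != 0.
Proof.
move=> ba ab x0; apply/eqP => N0.
have xr : x%:~R != 0 :> rat by rewrite intr_eq0.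
have := congr1 (intr : int -> rat) N0.
rewrite !(rmorphB, rmorphD, rmorphM, rmorphXn) /= => N0'.
apply: (negP (cubic_root_rat (y%:~R / x%:~R) ba ab)).
rewrite rootE horner_cubic; apply/eqP; apply: (mulfI (expf_neq0 3 xr)).
rewrite mulr0 -[RHS]N0'.
by field.
Qed.

Lemma norm_form_factor (R : realType) (a b x y : int) (u w : R) :
  root_data a b u w ->
  (y ^+ 3 - a * y ^+ 2 * x + b * y * x ^+ 2 - x ^+ 3)%:~R =
  (y%:~R - u * x%:~R) * (y%:~R ^+ 2 - w * x%:~R * y%:~R + x%:~R ^+ 2 / u).
Proof.
case=> u1 ea eb _; rewrite !(rmorphB, rmorphD, rmorphM, rmorphXn) /= -ea -eb.
by field; apply/eqP; lra.
Qed.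

(** The bounds 3 and 52 are those of the trace differences in [root_data_inj]; indeed
    [52^2 + 281 + 9 <= 3025]. *)
Lemma quadratic_form_bound (R : realFieldType) (x y w v : R) :
  `|x| <= 3 -> `|y| <= 52 -> `|w| <= 9 / 5 -> 0 <= v <= 1 ->
  `|y ^+ 2 - w * x * y + x ^+ 2 * v| <= 3025.
Proof.
move=> x3 y52 w95 /andP[v0 v1].
have ww : 9 / 5 * 3 * 52 <= 281 :> R by lra.
have wxy : `|w| * `|x| * `|y| <= 9 / 5 * 3 * 52 by rewrite !ler_pM ?mulr_ge0.
have xx : `|x| ^+ 2 <= 9 by rewrite (_ : 9 = 3 ^+ 2) ?lerXn2r ?nnegrE //; ring.
have yy : `|y| ^+ 2 <= 52 ^+ 2 by rewrite lerXn2r ?nnegrE.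
have xv : `|x| ^+ 2 * v <= 9 * 1 by rewrite ler_pM ?exprn_ge0.
have h1 := ler_normD (y ^+ 2 - w * x * y) (x ^+ 2 * v).
have h2 := ler_normB (y ^+ 2) (w * x * y).
rewrite !(normrM, normrX) (ger0_norm v0) in h1 h2.
by move: h1 h2 wxy xv yy ww; clear; lra.
Qed.

Section Closeness.
Variables (R : realType) (a1 b1 a2 b2 : int) (u1 w1 u2 w2 : R).
Hypotheses (d1 : root_data a1 b1 u1 w1) (d2 : root_data a2 b2 u2 w2).

Lemma root_data_re_lt a b (u w : R) : root_data a b u w -> `|w| < 9 / 5.
Proof.
move=> d; have := root_data_gap d; case: d => u1' _ _ w4 g.
have w5 : w ^+ 2 < (9 / 5) ^+ 2.
  have : 0 <= w ^+ 2 * (u - 5 / 4) by rewrite mulr_ge0 ?sqr_ge0 //; lra.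
  by lra.
by rewrite -ltr_sqr ?nnegrE ?real_normK ?num_real //; lra.
Qed.

Let h := `|u1 - u2|.
Let dx := a1 - a2.
Let dy := b1 - b2.
(* [b = u a - u^2 + 1/u], so [eta] is small when [u1] and [u2] are close. *)
Let eta := dy%:~R - u1 * dx%:~R : R.

Lemma eta_bound : `|eta| <= 4 * u1 * h.
Proof.
have g1 := root_data_gap d1; have g2 := root_data_gap d2.
have r2 := root_data_re_lt d2.
have u10 : 0 < u1 by lra. have u20 : 0 < u2 by lra.
(* The second factor is at most [9/5 + u1 + 1 <= 4 u1] in absolute value. *)
have -> : eta = (u1 - u2) * (w2 - u1 - (u1 * u2)^-1).
  rewrite /eta /dx /dy !rmorphB /=.
  case: d1 d2 => [_ <- <- _] [_ <- <- _]; field.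
  by rewrite !gt_eqF.
rewrite normrM -/h mulrC ler_wpM2r ?normr_ge0 //.
have i1 : 0 < (u1 * u2)^-1 by rewrite invr_gt0 mulr_gt0.
have i2 : (u1 * u2)^-1 < 1 by rewrite invf_lt1 ?mulr_gt0 //; nra.
by move: r2; rewrite !ltr_norml ler_norml => /andP[? ?]; lra.
Qed.

Lemma int_eq0_norm_lt1 (x : int) : `|x%:~R : R| < 1 -> x = 0.
Proof. by rewrite -intr_norm -(mulr1z 1) ltr_int; lia. Qed.

(** If [dx = 0], then [dy = eta] is an integer below 1 in size, hence 0. Otherwise [u1 <= 17], and
    the norm form at [(dx, dy)] is a nonzero integer of size at most [3025 * 68 h], whereas
    [h < 1 / 210000]. *)
Lemma root_data_inj : h <= 1 / 60 -> 4 * u1 * h < 1 ->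
  (u1 <= 17 -> 300 * (700 * h) < 1) -> a1 = a2 /\ b1 = b2.
Proof.
move=> h60 hu h17; have eb := eta_bound.
have g1 := root_data_gap d1; have g2 := root_data_gap d2.
have u10 : 0 < u1 by lra.
have [ba1 ab1] := root_data_lt d1.
have r1 := root_data_re_lt d1; have r2 := root_data_re_lt d2.
have h0 : 0 <= h by rewrite normr_ge0.
have [dx0|dx0] := eqVneq dx 0.
  have dy0 : dy = 0.
    apply: int_eq0_norm_lt1; move: eb.
    by rewrite /eta dx0 mulr0 subr0; lra.
  by split; apply/eqP; rewrite -subr_eq0; apply/eqP.
have dxE : dx%:~R = (u1 - u2) + (w1 - w2).
  by rewrite /dx rmorphB /=; case: d1 d2 => [_ <- _ _] [_ <- _ _]; ring.
have dx_ub : `|dx%:~R : R| <= h + `|w1| + `|w2|.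
  by rewrite dxE (le_trans (ler_normD _ _)) // -addrA lerD2l ler_normB.
have dx3 : `|dx%:~R : R| <= 3.
  have : `|dx%:~R : R| < 4%:~R by lra.
  rewrite -intr_norm ltr_int => i4.
  have : `|dx|%:~R <= 3%:~R :> R by rewrite ler_int; move: i4; clear; lia.
  by [].
have dx1 : 1 <= `|dx%:~R : R|.
  have : 1%:~R <= `|dx|%:~R :> R by rewrite ler_int; move: dx0; clear; lia.
  by rewrite intr_norm.
(* A nonzero [dx] forces [|w1| + |w2| >= 1 - h], so one of them is at least 49/100, and [w^2 u <= 4]
   bounds that [u]. *)
have u17 : u1 <= 17.
  have uh : `|u1 - u2| <= h by [].
  have hw (u w : R) : 0 < u -> w ^+ 2 * u <= 4 -> 49 / 100 <= `|w| ->
      u <= 33 / 2 + 1 / 5.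
    move=> u0 w4 w49.
    have : (49 / 100) ^+ 2 <= w ^+ 2.
      by rewrite -(real_normK (num_real w)) ler_sqr ?nnegrE //; lra.
    by nra.
  have [w49|w49] := lerP (49 / 100) `|w1|.
    by case: d1 => _ _ _ q1; have := hw u1 w1 u10 q1 w49; lra.
  have w49' : 49 / 100 <= `|w2| by lra.
  case: d2 => _ _ _ q2; have := hw u2 w2 _ q2 w49'.
  by move: uh; rewrite ler_norml => /andP[_ ?] ?; lra.
have {}h17 := h17 u17.
have eta_h : `|eta| <= 68 * h by nra.
have dy52 : `|dy%:~R : R| <= 52.
  have -> : dy%:~R = eta + u1 * dx%:~R by rewrite /eta; ring.
  rewrite (le_trans (ler_normD _ _)) // normrM (ger0_norm (ltW u10)).
  have : u1 * `|dx%:~R : R| <= 17 * 3 by apply: ler_pM => //; lra.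
  by lra.
pose N := dy ^+ 3 - a1 * dy ^+ 2 * dx + b1 * dy * dx ^+ 2 - dx ^+ 3.
have N0 : N != 0 by apply: norm_form_neq0 => //; move: ba1 ab1; clear; lia.
exfalso; move/eqP: N0; apply; apply: int_eq0_norm_lt1.
have -> : N%:~R = eta * (dy%:~R ^+ 2 - w1 * dx%:~R * dy%:~R + dx%:~R ^+ 2 / u1).
  exact: (norm_form_factor dx dy d1).
set Q := (X in eta * X); rewrite normrM.
have ui : 0 <= u1^-1 <= 1.
  by rewrite invr_ge0 (ltW u10) invf_le1 //; case: d1 => /ltW.
have Q3025 : `|Q| <= 3025 by apply: quadratic_form_bound => //; apply: ltW.
have : `|eta| * `|Q| <= 68 * h * 3025 by apply: ler_pM.
by lra.
Qed.

End Closeness.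

(** * Cubic units that are not proper powers *)

Lemma powsum2 a b : powsum a b 2 = a ^+ 2 - 2 * b.
Proof. by []. Qed.

Lemma powsum3 a b : powsum a b 3 = a ^+ 3 - 3 * a * b + 3.
Proof. by rewrite /powsum /=; ring. Qed.

Lemma mod2_cases (a : int) : exists c, a = 2 * c \/ a = 2 * c + 1.
Proof. by exists (a %/ 2)%Z; lia. Qed.

(** Divisibility by 4 forces [b] even, then [a] even. *)
Lemma square_trace_odd (a b : int) :
  (4 %| b ^+ 2 - 2 * a)%Z -> (2 %| a ^+ 2 - 2 * b)%Z.
Proof.
have [c [->|->]] := mod2_cases a; have [d [->|->]] := mod2_cases b; rewrite !expr2; lia.
Qed.

(** Here [a] is even, so the number is [b^2 - 2] modulo 4, and 2 is not a square modulo 4. *)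
Lemma square_trace_even (a b : int) :
  (2 %| a ^+ 2 - 2 * b)%Z -> ~~ (4 %| b ^+ 2 - 2 * a - 2)%Z.
Proof.
have [c [->|->]] := mod2_cases a; have [d [->|->]] := mod2_cases b; rewrite !expr2; lia.
Qed.

(** Either residue would make 3 divide [b], and then the trace is 3 modulo 9. *)
Lemma cube_trace (a b : int) :
  ~~ (9 %| b ^+ 3 - 3 * b * a + 3)%Z && ~~ (9 %| b ^+ 3 - 3 * b * a + 3 - 6)%Z.
Proof.
have [c [->|[->|->]]] : exists c, b = 3 * c \/ b = 3 * c + 1 \/ b = 3 * c + 2.
  by exists (b %/ 3)%Z; lia.
all: rewrite !exprS expr0; lia.
Qed.

Section UnitPower.
Variable R : realType.
Implicit Types A B : int.

Lemma not_unit_power2_odd A B : (4 %| B)%Z -> ~~ (2 %| A)%Z ->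
  ~ unit_power R A B 2.
Proof.
move=> B4 A2 [a [b [u [w [_ eA eB _]]]]].
by rewrite -eA square_trace_odd // -powsum2 eB in A2.
Qed.

Lemma not_unit_power2_even A B : (2 %| A)%Z -> (4 %| B - 2)%Z ->
  ~ unit_power R A B 2.
Proof.
move=> A2 B4 [a [b [u [w [_ eA eB _]]]]].
by have := @square_trace_even a b; rewrite -!powsum2 eA eB B4 => /(_ A2).
Qed.

Lemma not_unit_power3 A B : (9 %| B)%Z || (9 %| B - 6)%Z -> ~ unit_power R A B 3.
Proof.
move=> B9 [a [b [u [w [_ _ eB _]]]]].
by have := cube_trace a b; rewrite -powsum3 eB -negb_or B9.
Qed.

(** From [(5/4)^4 > 2] and [u >= 5/4], an exponent [m >= 4 l] would give [u^m >= 2^l]. *)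
Lemma unit_power_exponent_lt A B m l :
  unit_power R A B m -> A%:~R + 2 < (2 : R) ^+ l -> (m < 4 * l)%N.
Proof.
move=> [a [b [u [w [d _ _ uA]]]]] Al; rewrite ltnNge; apply/negP => lm.
have g := root_data_gap d.
have h1 : (2 : R) ^+ l <= (5 / 4) ^+ (4 * l).
  rewrite exprM lerXn2r ?nnegrE ?exprn_ge0 //; lra.
have h2 : (5 / 4 : R) ^+ (4 * l) <= u ^+ m.
  apply: (@le_trans _ _ (u ^+ (4 * l))).
    by rewrite lerXn2r // ?nnegrE; lra.
  by rewrite ler_weXn2l //; lra.
move: uA; rewrite ler_norml => /andP[_ uA].
by lra.
Qed.

(* Since [u1 ^+ m] and [u2 ^+ m] differ by at most [H] and exceed [1000 H ^+ 2],
   their [m]-th roots are so close that [root_data_inj] applies. *)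
Lemma unit_power_inj A1 B1 A2 B2 m (H : R) :
  (5 <= m)%N -> unit_power R A1 B1 m -> unit_power R A2 B2 m ->
  5000 <= H -> `|(A1 - A2)%:~R| + 4 <= H -> 1000 * H ^+ 2 <= A1%:~R - 2 ->
  A1 = A2 /\ B1 = B2.
Proof.
move=> m5 [a1 [b1 [u1 [w1 [d1 eA1 eB1 uA1]]]]] [a2 [b2 [u2 [w2 [d2 eA2 eB2 uA2]]]]].
move=> H5 AH HA.
suff [ea eb] : a1 = a2 /\ b1 = b2 by rewrite -eA1 -eA2 -eB1 -eB2 ea eb.
have g1 := root_data_gap d1; have g2 := root_data_gap d2.
have u1_1 : 1 <= u1 by lra.
have u10 : 0 < u1 by lra. have u20 : 0 < u2 by lra.
have [u1_0 u2_0] : 0 <= u1 /\ 0 <= u2 by split; apply: ltW.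
set h := `|u1 - u2|; have h0 : 0 <= h by rewrite normr_ge0.
set th := u1 ^+ m.
have thH : 1000 * H ^+ 2 <= th.
  by move: uA1; rewrite ler_norml /th => /andP[? _]; lra.
have hth : h * th <= H * u1.
  case: m m5 {eA1 eA2 eB1 eB2} @th thH uA1 uA2 => // m m5 th thH uA1 uA2.
  have : h * u1 ^+ m <= H.
    have : `|u1 ^+ m.+1 - u2 ^+ m.+1| <= H.
      have -> : u1 ^+ m.+1 - u2 ^+ m.+1 = (u1 ^+ m.+1 - A1%:~R) +
        (A1 - A2)%:~R - (u2 ^+ m.+1 - A2%:~R) by rewrite rmorphB /=; ring.
      apply: (le_trans (ler_normB _ _)).
      have := ler_normD (u1 ^+ m.+1 - A1%:~R) (A1 - A2)%:~R.
      by lra.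
    (* Of the cofactor of [u1 - u2], only the term [u1^(m-1)] is kept. *)
    apply: le_trans; rewrite subrXX normrM -/h ler_wpM2l //.
    rewrite big_ord_recl /= subn0 expr0 mulr1 ger0_norm; last first.
      by rewrite addr_ge0 ?exprn_ge0 ?sumr_ge0 // => i _; rewrite mulr_ge0 ?exprn_ge0.
    rewrite lerDl sumr_ge0 // => i _.
    by rewrite mulr_ge0 ?exprn_ge0.
  by rewrite /th exprSr mulrA => hh; rewrite ler_wpM2r.
have u5 : u1 ^+ 5 <= th by rewrite /th ler_weXn2l.
have th0 : 0 < th by rewrite exprn_gt0.
move: thH hth u5 th0 {uA1 uA2 AH HA}; clearbody th => thH hth u5 th0.
(* If [u1^3 > 4 H], use [u1^5 <= th], which needs [m >= 5]; otherwise [u1^2 <= 4 H] and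
   [16 H^2 < 1000 H^2 <= th]. *)
have c1 : 4 * H * u1 ^+ 2 < th.
  have [u3|u3] := ltrP (4 * H) (u1 ^+ 3).
    apply: lt_le_trans u5.
    rewrite [u1 ^+ 5](_ : _ = u1 ^+ 3 * u1 ^+ 2); last by rewrite -exprD.
    by rewrite ltr_pM2r // exprn_gt0.
  have u23 : u1 ^+ 2 <= u1 ^+ 3 by rewrite ler_weXn2l.
  by nra.
have c2 : 4 * u1 * h < 1.
  have : 4 * u1 * (h * th) <= 4 * u1 * (H * u1) by rewrite ler_wpM2l //; lra.
  rewrite -(ltr_pM2r th0) mul1r; move: c1; rewrite expr2; lra.
(* It suffices that [210000 * 17 H < 1000 H^2], which holds since [H >= 5000]. *)
have c3 : u1 <= 17 -> 300 * (700 * h) < 1.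
  move=> u17; rewrite -(ltr_pM2r th0) mul1r.
  by nra.
apply: (root_data_inj d1 d2) => //; rewrite -/h.
have [u17|u17] := lerP u1 17; first by have := c3 u17; lra.
by nra.
Qed.

End UnitPower.

(** * Choosing A and B: pigeonhole for large k, computation for small k *)

Definition nonpower (R : realType) (A B : int) : Prop :=
  forall m, (m == 2) || (m == 3) || (5 <= m)%N -> ~ unit_power R A B m.

(** The base [144 l + 112] is [36 (4 l + 3) + 4]: the spread of the trial values of [B], plus the 4
    allowed for in [unit_power_inj]. The inequality fails at [l = 34]. *)
Lemma square_growth (R : realType) (l : nat) : (35 <= l)%N ->
  1024 * (144 * l%:R + 112) ^+ 2 <= (2 : R) ^+ l.
Proof.
elim: l => // l IH; rewrite leq_eqVlt => /orP[/eqP <-|].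
  have -> : (2 : R) ^+ 35 = (2 ^+ 10) ^+ 3 * 2 ^+ 5 by rewrite -exprM -exprD.
  have -> : (2 : R) ^+ 10 = 1024 by ring.
  by lra.
rewrite ltnS => l35; have := IH l35; rewrite -[l.+1%:R]natr1 [2 ^+ l.+1]exprS.
have : (35 : R) <= l%:R by rewrite ler_nat.
move: (l%:R : R) (2 ^+ l : R) => x y x35 xy.
have : (144 * (x + 1) + 112) ^+ 2 <= 2 * (144 * x + 112) ^+ 2.
  have : 0 <= (x - 35) * x by rewrite mulr_ge0; lra.
  by rewrite !expr2; nra.
by lra.
Qed.

(** Read [y] as [k], [x] as [B] and [y - 2 - x] as [A]. The conclusions serve [l1_cubic_mul], the
    uniqueness of the real root and [unit_power_inj]. *)
Lemma window_bounds (R : realType) (x y H : R) :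
  5000 <= H -> 1024 * H ^+ 2 <= y -> 0 <= x <= H + 2 ->
  [/\ 3 * x + 6 <= y - 2 - x, (x + 1) ^+ 2 <= 4 * (y - 2 - x - 1) &
      1000 * H ^+ 2 <= y - 2 - x - 2].
Proof.
move=> H5 Hy /andP[x0 xH].
have HH : 5000 * H <= H ^+ 2 by rewrite expr2 ler_wpM2r //; lra.
have xx : (x + 1) ^+ 2 <= (H + 3) ^+ 2 by rewrite lerXn2r ?nnegrE //; lra.
have {}xx : (x + 1) ^+ 2 <= H ^+ 2 + 6 * H + 9.
  by apply: (le_trans xx); rewrite !expr2; lra.
by split; lra.
Qed.

Lemma exists_nonpower_large (R : realType) (k : nat) :
  (2 : R) ^+ 35 <= k%:R -> exists A B : int,
  [/\ A + `|B| + 2 = k, 3 * `|B| + 6 <= A, (`|B| + 1) ^+ 2 <= 4 * (A - 1) &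
      nonpower R A B].
Proof.
move=> k35; have k0 : (0 < k)%N.
  by rewrite -(ltr0n R); apply: lt_le_trans k35; rewrite exprn_gt0.
have /andP[lk kl] := trunc_log_bounds (isT : (1 < 2)%N) k0.
move: (trunc_log 2 k) lk kl => l; rewrite -(ler_nat R) -(ltr_nat R) !natrX => lk kl.
have l35 : (35 <= l)%N.
  rewrite leqNgt; apply/negP => l34.
  have : (2 : R) ^+ l.+1 <= 2 ^+ 35 by rewrite ler_weXn2l // ler1n.
  by move=> h; have := le_lt_trans (le_trans h k35) kl; rewrite ltxx.
have growth := square_growth R l35.
pose H : R := 144 * l%:R + 112; rewrite -/H in growth.
have H5000 : 5000 <= H.
  have : (35 : R) <= l%:R by rewrite ler_nat.
  by rewrite /H; lra.
(* For odd [k], [A] is odd and [B] is 0 modulo 36; for even [k], [A] is even and [B] is 2 modulo 4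
   and 6 modulo 9. Squares and cubes are thus excluded. *)
pose b0 := (if odd k then 0 else 6)%N.
pose b (i : nat) := (b0 + 36 * i)%N.
pose B (i : nat) : int := b i; pose A (i : nat) : int := k%:Z - 2 - B i.
have b06 : (b0 <= 6)%N by rewrite /b0; case: ifP.
have bH (i : 'I_(4 * l + 4)) : (b i)%:R <= H + 2.
  have : (b i <= 36 * (4 * l + 3) + 6)%N.
    by rewrite /b; have := ltn_ord i; move: b06; clear; lia.
  rewrite -(ler_nat R) !(natrD, natrM) /H; lra.
have AE i : (A i)%:~R = k%:R - 2 - (b i)%:R :> R.
  by rewrite /A /B !rmorphB.
have kH : 1024 * H ^+ 2 <= k%:R by lra.
have not2 i : ~ unit_power R (A i) (B i) 2.
  have [ko|ke] := boolP (odd k).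
    by apply: not_unit_power2_odd; rewrite /A /B /b /b0 ko; move: ko; clear; lia.
  apply: not_unit_power2_even; rewrite /A /B /b /b0 (negPf ke); move: ke; clear; lia.
have not3 i : ~ unit_power R (A i) (B i) 3.
  by apply: not_unit_power3; rewrite /B /b /b0; case: ifP => _; clear; lia.
suff [i npi] : exists i : 'I_(4 * l + 4), nonpower R (A i) (B i).
  exists (A i), (B i).
  have bi : 0 <= ((b i)%:R : R) <= H + 2 by rewrite ler0n bH.
  have [hA hB _] := window_bounds H5000 kH bi.
  have normB : `|B i| = B i by [].
  have BE : (B i)%:~R = (b i)%:R :> R by [].
  split=> //; rewrite normB.
  - by rewrite /A addrNK addrNK.
  - by rewrite -(ler_int R) rmorphD rmorphM /= BE AE.
  - by rewrite -(ler_int R) rmorphXn rmorphM rmorphB rmorphD /= BE AE.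
have [//|nex] := pselect (exists i : 'I_(4 * l + 4), nonpower R (A i) (B i)).
have exm (i : 'I_(4 * l + 4)) : exists m, (5 <= m)%N /\ unit_power R (A i) (B i) m.
  have [//|nm] := pselect (exists m, (5 <= m)%N /\ unit_power R (A i) (B i) m).
  exfalso; apply: nex; exists i => m /orP[/orP[/eqP ->|/eqP ->]|m5].
  - exact: not2.
  - exact: not3.
  - by move=> um; apply: nm; exists m.
have [m hm] := choice exm.
have mlt i : (m i < 4 * l.+1)%N.
  have [_ um] := hm i; apply: (unit_power_exponent_lt um).
  have bi0 : 0 <= (b i)%:R :> R by rewrite ler0n.
  by rewrite AE; move: kl bi0; clear; lra.
(* Shifting the exponents by one leaves [4 l + 3] places for [4 l + 4] values of [B], so the
   injectivity shown next is absurd. *)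
have mlt' i : ((m i).-1 < 4 * l + 3)%N.
  by have := mlt i; have [] := hm i; clear; lia.
have : injective (fun i => Ordinal (mlt' i)).
  move=> i j [mij]; have [mi ui] := hm i; have [mj uj] := hm j.
  have mE : m i = m j by move: mi mj mij; clear; lia.
  rewrite -mE in uj.
  have [||| _ /eqP] := @unit_power_inj R _ _ _ _ _ H mi ui uj.
  - exact: H5000.
  - rewrite rmorphB /= !AE.
    rewrite (_ : _ - _ - _ - _ = (b j)%:R - (b i)%:R); last by ring.
    have ibj (i' j' : 'I_(4 * l + 4)) : (b i')%:R - (b j')%:R <= H - 4 :> R.
      have : (b i' <= 36 * (4 * l + 3) + b j')%N.
        by rewrite /b; have := ltn_ord i'; clear; lia.
      rewrite -(ler_nat R) !(natrD, natrM) /H; clear; lra.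
    by rewrite -lerBrDr ler_norml; have := ibj i j; have := ibj j i; lra.
  - have bi : 0 <= ((b i)%:R : R) <= H + 2 by rewrite ler0n bH.
    by have [_ _] := window_bounds H5000 kH bi; rewrite AE.
  - rewrite /B => bij; apply: val_inj => /=; move: bij; rewrite /b; clear; lia.
by move/leq_card; rewrite !card_ord; clear; lia.
Qed.

(* The same recurrence over binary integers: [int] is unary. *)
Definition powsum_stepZ (a b : BinNums.Z) (s : BinNums.Z * BinNums.Z * BinNums.Z) :=
  (s.1.2, s.2,
   BinInt.Z.add (BinInt.Z.sub (BinInt.Z.mul a s.2) (BinInt.Z.mul b s.1.2)) s.1.1).

Fixpoint powsum_avoids (t a b : BinNums.Z) s (n : nat) : bool :=
  if n is n'.+1 then
    ~~ BinInt.Z.eqb s.1.1 t && powsum_avoids t a b (powsum_stepZ a b s) n'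
  else true.

Definition powsum_initZ (a b : BinNums.Z) :=
  (BinInt.Z.of_nat 3, a,
   BinInt.Z.sub (BinInt.Z.mul a a) (BinInt.Z.mul (BinInt.Z.of_nat 2) b)).

Definition Zstate (s : int * int * int) :=
  (ssrZ.Z_of_int s.1.1, ssrZ.Z_of_int s.1.2, ssrZ.Z_of_int s.2).

Lemma powsum_avoidsP (t : BinNums.Z) (a b : int) m0 n :
  let A := ssrZ.Z_of_int a in let B := ssrZ.Z_of_int b in
  powsum_avoids t A B (iter m0 (powsum_stepZ A B) (powsum_initZ A B)) n ->
  forall m, (m0 <= m < m0 + n)%N -> ssrZ.Z_of_int (powsum a b m) <> t.
Proof.
move=> A B; pose st m : int * int * int :=
  iter m (fun s => (s.1.2, s.2, a * s.2 - b * s.1.2 + s.1.1))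
    (3 : int, a, a ^+ 2 - 2 * b).
have stE m : iter m (powsum_stepZ A B) (powsum_initZ A B) = Zstate (st m).
  have ZB x y : ssrZ.Z_of_int (x - y) =
    BinInt.Z.sub (ssrZ.Z_of_int x) (ssrZ.Z_of_int y) by lia.
  have ZD x y : ssrZ.Z_of_int (x + y) =
    BinInt.Z.add (ssrZ.Z_of_int x) (ssrZ.Z_of_int y) by lia.
  have ZM x y : ssrZ.Z_of_int (x * y) =
    BinInt.Z.mul (ssrZ.Z_of_int x) (ssrZ.Z_of_int y) by lia.
  elim: m => [|m IH]; first by rewrite /Zstate /st [iter 0 _ _]/= expr2 ZB !ZM.
  rewrite [LHS]iterS IH /Zstate /powsum_stepZ ![(_, _).1]/= ![(_, _).2]/=.
  by rewrite -!(ZM, ZB, ZD).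
rewrite stE; elim: n m0 => [|n IH] m0 /=; first by move=> _ m; rewrite addn0; lia.
move=> /andP[/negP neq av] m /andP[m0m mn].
move: m0m; rewrite leq_eqVlt => /orP[/eqP <-|m0m].
  by move/BinInt.Z.eqb_eq.
apply: (IH m0.+1); last by rewrite m0m addSnnS.
by rewrite -stE /= stE.
Qed.

(* [u > a - 9/5] and [u ^+ m < 2 ^+ 35]. *)
Definition exponent_bound (i : nat) : nat :=
  if (i < 4)%N then 140 else if (i < 18)%N then 35 else 9.

(* For [b < a] and [-2 < a + b] see root_data_lt; the excluded pair
   (a, b) = (1, 0) gives the exceptional power of exponent 11. *)
Definition box_check (t : BinNums.Z) (na : nat) : bool :=
  all (fun i => all (fun j =>
    let a := BinInt.Z.of_nat i in
    let b := BinInt.Z.sub (BinInt.Z.of_nat j) (BinInt.Z.of_nat 23) in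
    [&& BinInt.Z.ltb b a,
        BinInt.Z.ltb (BinInt.Z.opp (BinInt.Z.of_nat 2)) (BinInt.Z.add a b) &
        ~~ (BinInt.Z.eqb a (BinInt.Z.of_nat 1) && BinInt.Z.eqb b BinNums.Z0)] ==>
    powsum_avoids t b a (iter 5 (powsum_stepZ b a) (powsum_initZ b a))
      (exponent_bound i - 5))
  (iota 0 47)) (iota 0 na).

Lemma box_check0 : box_check BinNums.Z0 130.
Proof. by vm_cast_no_check (erefl true). Qed.

Lemma box_check12 : box_check (BinInt.Z.opp (BinInt.Z.of_nat 12)) 5.
Proof. by vm_cast_no_check (erefl true). Qed.

Lemma box_checkP t na (a b : int) m :
  box_check t na -> b < a -> -2 < a + b -> ~~ ((a == 1) && (b == 0)) ->
  0 <= a -> a < na%:Z -> `|b| < 24 -> (5 <= m < exponent_bound `|a|)%N ->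
  ssrZ.Z_of_int (powsum b a m) <> t.
Proof.
move=> chk ba ab nab a0 ana b24 m5.
have [i ai] : exists i : nat, a = i by exists `|a|%N; lia.
have [j bj] : exists j : nat, b = j%:Z - 23 by exists `|(b + 23)%R|%N; lia.
have /allP/(_ i) := chk; rewrite mem_iota add0n.
have -> : (0 <= i < na)%N by lia.
move=> /(_ isT)/allP/(_ j); rewrite mem_iota add0n.
have -> : (0 <= j < 47)%N by lia.
move=> /(_ isT) /implyP h.
have aE : BinInt.Z.of_nat i = ssrZ.Z_of_int a by rewrite ai.
have bE : BinInt.Z.sub (BinInt.Z.of_nat j) (BinInt.Z.of_nat 23) = ssrZ.Z_of_int b.
  by rewrite bj; clear; lia.
rewrite aE bE in h; apply: (powsum_avoidsP (h _)); last first.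
  by move: m5; rewrite ai /=; move: (exponent_bound i) => M; clear; lia.
apply/and3P; split; first by apply/BinInt.Z.ltb_lt; lia.
- by apply/BinInt.Z.ltb_lt; lia.
- apply: contra nab => /andP[/BinInt.Z.eqb_eq a1 /BinInt.Z.eqb_eq b0].
  by apply/andP; split; apply/eqP; lia.
Qed.

(** From [u^5 <= A + 2 < 2^35] follows [u < 128], so [a = u + w < 130], and [(u w)^2 <= 4 u < 23^2]
    gives [|b| < 24]. If [A < 90], then [u < 5/2]. *)
Lemma unit_power_box (R : realType) (A B : int) m :
  (5 <= m)%N -> unit_power R A B m -> A%:~R + 2 < (2 : R) ^+ 35 ->
  exists a b : int, [/\ b < a, -2 < a + b, 0 <= a < 130 & `|b| < 24] /\
    [/\ (A < 90 -> a < 5), (m < exponent_bound `|a|)%N,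
        powsum a b m = A & powsum b a m = B].
Proof.
move=> m5 up A35; have m140 := unit_power_exponent_lt up A35.
case: up => [a [b [u [w [d eA eB uA]]]]]; exists a, b.
have [ba ab] := root_data_lt d; have g := root_data_gap d.
have w95 := root_data_re_lt d; have [_ uw] := root_data_norm_bounds d.
have u0 : 0 < u by lra.
have u5 : u ^+ 5 <= A%:~R + 2.
  apply: (@le_trans _ _ (u ^+ m)); first by rewrite ler_weXn2l //; lra.
  by move: uA; rewrite ler_norml => /andP[_ uA]; lra.
have u128 : u < 128.
  rewrite -(@ltr_pXn2r _ 5) ?nnegrE //; lra.
have [ea eb] : u + w = a%:~R /\ u * w + u^-1 = b%:~R by case: d.
have [w1 w2] : - (9 / 5) < w /\ w < 9 / 5 by apply/andP; rewrite -ltr_norml.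
have ui0 : 0 < u^-1 by rewrite invr_gt0.
have ui1 : u^-1 < 1 by rewrite invf_lt1 //; lra.
have uw23 : `|u * w| < 23.
  by rewrite -(ltr_pXn2r (isT : (0 < 2)%N)) ?nnegrE // real_normK ?num_real //; lra.
have m_lt e : (0 < e)%N -> (2 : R) ^+ e <= u -> (e * m < 35)%N.
  move=> e0 eu; rewrite -(ltr_eXn2l (ltr1n R 2)) exprM.
  apply: le_lt_trans A35; apply: (@le_trans _ _ (u ^+ m)).
    by rewrite lerXn2r // nnegrE ?exprn_ge0 //; lra.
  by move: uA; rewrite ler_norml => /andP[_ uA]; lra.
have a0 : 0 <= a.
  have : (-1)%:~R < a%:~R :> R by rewrite -ea rmorphN /=; lra.
  by rewrite ltr_int; clear; lia.
split; split=> //.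
- by rewrite a0 -(ltr_int R) -ea [130%:~R](_ : _ = 130) //; lra.
- rewrite -(ltr_int R) intr_norm -eb [24%:~R](_ : _ = 24) //.
  by move: uw23; rewrite !ltr_norml => /andP[? ?]; apply/andP; split; lra.
- move=> A90; have u52 : u < 5 / 2.
    rewrite -(@ltr_pXn2r _ 5) ?nnegrE //; try lra.
    have : A%:~R < 90%:~R :> R by rewrite ltr_int.
    by rewrite [90%:~R](_ : _ = 90) //; lra.
  by rewrite -(ltr_int R) -ea [5%:~R](_ : _ = 5) //; lra.
(* For [a >= 4], [u > 2] gives [m < 35]; for [a >= 18], [u > 16] gives [4 m < 35]. *)
- rewrite /exponent_bound.
  case: (ltnP `|a| 4) => // a4; case: (ltnP `|a| 18) => a18.
    have : 4%:~R <= a%:~R :> R by rewrite ler_int; move: a0 a4; clear; lia.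
    rewrite -ea [4%:~R](_ : _ = 4) // => u2.
    by rewrite -[m in (m < _)%N]mul1n m_lt // expr1; lra.
  have : 18%:~R <= a%:~R :> R by rewrite ler_int; move: a0 a18; clear; lia.
  rewrite -ea [18%:~R](_ : _ = 18) // => u16.
  have : (2 : R) ^+ 4 <= u by lra.
  by move/(m_lt 4%N isT); clear; lia.
Qed.

(** The pair [a = 1], [b = 0] left out of [box_check]: the cubic [X^3 - X^2 - 1], of discriminant
    -31. *)
Lemma powsum_avoids_root31 (t : BinNums.Z) m0 n :
  powsum_avoids t BinNums.Z0 (BinInt.Z.of_nat 1)
    (iter m0 (powsum_stepZ BinNums.Z0 (BinInt.Z.of_nat 1))
       (powsum_initZ BinNums.Z0 (BinInt.Z.of_nat 1))) n ->
  forall m, (m0 <= m < m0 + n)%N -> ssrZ.Z_of_int (powsum 0 1 m) <> t.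
Proof. exact: (@powsum_avoidsP t 0 1). Qed.

Lemma nonpower_55_12 (R : realType) : nonpower R 55 (- 12).
Proof.
move=> m /orP[/orP[/eqP ->|/eqP ->]|m5].
- exact: not_unit_power2_odd.
- exact: not_unit_power3.
move=> up; have [|a [b [[ba ab /andP[a0 a130] b24] [a5 mbd _ eB]]]] :=
    unit_power_box m5 up.
  have -> : (2 : R) ^+ 35 = (2 ^+ 7) ^+ 5 by rewrite -exprM.
  have -> : (2 : R) ^+ 7 = 128 by ring.
  by rewrite [55%:~R](_ : _ = 55) //; lra.
have [/andP[/eqP a1 /eqP b0]|nab] := boolP ((a == 1) && (b == 0)).
  suff : ssrZ.Z_of_int (powsum 0 1 m) <> BinInt.Z.opp (BinInt.Z.of_nat 12).
    by rewrite -a1 -b0 eB.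
  apply: (@powsum_avoids_root31 _ 5 135); first by vm_cast_no_check (erefl true).
  by rewrite m5; move: mbd; rewrite a1.
have bd : (5 <= m < exponent_bound `|a|)%N by rewrite m5.
by apply: (box_checkP box_check12 ba ab nab a0 (a5 isT) b24 bd); rewrite eB.
Qed.

Lemma nonpower_trace0 (R : realType) (k : nat) :
  (3 <= k)%N -> k != 69%N -> k%:R < (2 : R) ^+ 35 ->
  ~ (exists t : int, [/\ t != 0, t != 1 & k%:Z = 4 * t ^+ 4 - 4 * t + 2]) ->
  nonpower R (k%:Z - 2) 0.
Proof.
move=> k3 k69 k35 hform m /orP[/orP[/eqP ->|/eqP ->]|m5].
- move=> [a [b [u [w [_]]]]]; rewrite !powsum2 => eA eB _; apply: hform.
  (* Here [B = 0] reads [b^2 = 2 a], so [b = 2 t], [a = 2 t^2] and [A = 4 t^4 - 4 t]. *)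
  have [t [bt|bt]] := mod2_cases b; last first.
    by exfalso; move: eB; rewrite bt !expr2; clear; lia.
  have at2 : a = 2 * t ^+ 2.
    by move: eB; rewrite bt !expr2; clear; lia.
  have kt : k%:Z = 4 * t ^+ 4 - 4 * t + 2.
    apply: (addIr (- 2)); rewrite -[LHS]eA at2 bt; ring.
  (* Both [t = 0] and [t = 1] would give [k = 2]. *)
  exists t; split=> //; apply: contraTneq k3 => t0; move: kt; rewrite t0.
  + by rewrite expr0n /=; clear; lia.
  + by rewrite expr1n; clear; lia.
- exact: not_unit_power3.
move=> up; have [|a [b [[ba ab /andP[a0 a130] b24] [_ mbd eA eB]]]] :=
    unit_power_box m5 up.
  by rewrite rmorphB /= -pmulrn; lra.
have [/andP[/eqP a1 /eqP b0]|nab] := boolP ((a == 1) && (b == 0)); last first.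
  have bd : (5 <= m < exponent_bound `|a|)%N by rewrite m5.
  by apply: (box_checkP box_check0 ba ab nab a0 a130 b24 bd); rewrite eB.
rewrite a1 b0 in eA eB mbd; have [m11|m11] := eqVneq m 11%N.
  (* The 11th power has trace 67, that is [k = 69]. *)
  move: eA; rewrite m11 (_ : powsum 1 0 11 = 67); last by vm_compute.
  by move/eqP: k69; clear; lia.
have [mlt|mgt] := ltnP m 11.
  have : ssrZ.Z_of_int (powsum 0 1 m) <> BinNums.Z0; last by rewrite eB.
  by apply: (@powsum_avoids_root31 _ 5 6); [vm_cast_no_check (erefl true) | rewrite m5].
have : ssrZ.Z_of_int (powsum 0 1 m) <> BinNums.Z0; last by rewrite eB.
apply: (@powsum_avoids_root31 _ 12 128); first by vm_cast_no_check (erefl true).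
by rewrite mbd ltn_neqAle eq_sym m11 mgt.
Qed.

(** * The field and its shortest vanishing sums *)

Lemma exists_nonpower (R : realType) (k : nat) : (3 <= k)%N ->
  ~ (exists t : int, [/\ t != 0, t != 1 & k%:Z = 4 * t ^+ 4 - 4 * t + 2]) ->
  exists A B : int, [/\ A + `|B| + 2 = k, 1 <= A,
    B = 0 \/ 3 * `|B| + 6 <= A /\ (`|B| + 1) ^+ 2 <= 4 * (A - 1) &
    nonpower R A B].
Proof.
move=> k3 hform; have [k35|k35] := lerP ((2 : R) ^+ 35) k%:R.
  have [A [B [kE AB B2 np]]] := exists_nonpower_large k35.
  by exists A, B; split=> //; [lia | right].
have [->|k69] := eqVneq k 69%N.
  exists 55, (- 12); split=> //; [right; split=> // | exact: nonpower_55_12].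
exists (k%:Z - 2), 0; split; [lia | lia | by left | exact: nonpower_trace0].
Qed.

Lemma map_poly_int_rat (K : fieldExtType rat) (p : {poly int}) :
  map_poly (in_alg K) (map_poly intr p) = map_poly intr p.
Proof.
by rewrite -map_poly_comp; apply: eq_map_poly => x; exact: (rmorph_int (in_alg K)).
Qed.

Lemma map_poly_ratr_int (F : numFieldType) (p : {poly int}) :
  map_poly (ratr : rat -> F) (map_poly intr p) = map_poly intr p.
Proof. by rewrite -map_poly_comp; apply: eq_map_poly => x /=; rewrite ratr_int. Qed.

(** The sign changes between [A] and [A + 1] if [B = 0], and between [A - 1] and [A + 1] otherwise.
    The bound on [4 th] will make the quadratic cofactor have negative discriminant. *)
Lemma cubic_real_root (R : realType) (A B : int) : 1 <= A ->
  B = 0 \/ 3 * `|B| + 6 <= A /\ (`|B| + 1) ^+ 2 <= 4 * (A - 1) ->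
  exists th : R, [/\ (map_poly intr (cubic A B)).[th] = 0, 1 < th,
    (`|B|%:~R + 1) ^+ 2 < 4 * th & B = 0 -> A%:~R < th].
Proof.
move=> A1 hB; set f := map_poly intr (cubic A B) : {poly R}.
have fE x : f.[x] = x ^+ 3 - A%:~R * x ^+ 2 + B%:~R * x - 1 by apply: horner_cubic.
have A1R : 1 <= A%:~R :> R by rewrite -(mulr1z 1) ler_int.
case: hB => [B0|[AB AB2]].
  have [||th /andP[th1 _] /rootP th0] := @poly_ivt R f A%:~R (A%:~R + 1).
  - by lra.
  - by rewrite !fE B0; apply/andP; split; nra.
  have Ath : A%:~R < th.
    rewrite lt_neqAle th1 andbT; apply/eqP => th'.
    by move: th0; rewrite -th' fE B0; lra.
  by exists th; split=> //; rewrite ?B0 ?normr0 ?expr2; lra.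
have Bn : `|B%:~R : R| = `|B|%:~R by rewrite intr_norm.
have ABR : 3 * `|B|%:~R + 6 <= A%:~R :> R.
  by move: AB; rewrite -(ler_int R) rmorphD rmorphM.
have AB2R : (`|B|%:~R + 1) ^+ 2 <= 4 * (A%:~R - 1) :> R.
  by move: AB2; rewrite -(ler_int R) rmorphXn rmorphM rmorphB rmorphD.
have [Bl Bu] : - `|B|%:~R <= B%:~R :> R /\ B%:~R <= `|B|%:~R :> R.
  by apply/andP; rewrite -ler_norml Bn.
have B0 : 0 <= `|B|%:~R :> R by rewrite -Bn.
have lt0 : f.[A%:~R - 1] < 0 by rewrite fE; nra.
have [||th /andP[th1 _] /rootP th0] := @poly_ivt R f (A%:~R - 1) (A%:~R + 1).
- by lra.
- by rewrite (ltW lt0) fE /=; nra.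
have Ath : A%:~R - 1 < th.
  rewrite lt_neqAle th1 andbT; apply/eqP => th'.
  by move: lt0; rewrite th' th0 ltxx.
exists th; split=> //; try lra.
move=> B0'; move: th0; rewrite fE B0' mul0r addr0 => th0.
have : 0 < th ^+ 2 * (th - A%:~R) by lra.
by rewrite pmulr_rgt0 ?subr_gt0 // exprn_gt0 //; lra.
Qed.

Lemma cubic_conjugates (R : realType) (A B : int) (th : R) :
  (map_poly intr (cubic A B)).[th] = 0 -> 1 < th ->
  (`|B|%:~R + 1) ^+ 2 < 4 * th ->
  (forall x : R, (map_poly intr (cubic A B)).[x] = 0 -> x = th) /\
  exists g : R[i],
  [/\ (map_poly intr (cubic A B)).[g] = 0,
      real_complex R th + g + conjc g = A%:~R,
      real_complex R th * g + g * conjc g + conjc g * real_complex R th = B%:~R &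
      real_complex R th * g * conjc g = 1].
Proof.
rewrite horner_cubic => th0 th1 Bth; pose w := A%:~R - th.
have thn0 : th != 0 by rewrite gt_eqF //; lra.
have thw : th * w = B%:~R - th^-1.
  apply: (mulfI thn0); rewrite [RHS]mulrBr divff // /w.
  by move: th0; rewrite !exprS expr0; lra.
have ti0 : 0 < th^-1 by rewrite invr_gt0; lra.
have ti1 : th^-1 < 1 by rewrite invf_lt1 //; lra.
(* The cofactor is [X^2 - w X + 1/th]; its discriminant is negative because [|th w| <= |B| + 1]. *)
have w4 : w ^+ 2 < 4 * th^-1.
  have : (th * w) ^+ 2 <= (`|B|%:~R + 1) ^+ 2.
    rewrite -(real_normK (num_real (th * w))) lerXn2r ?nnegrE ?addr_ge0 ?ler0z //.
    rewrite thw (le_trans (ler_normB _ _)) // -intr_norm lerD2l gtr0_norm //.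
    exact: ltW.
  move=> h; have {h} : (th * w) ^+ 2 < 4 * th by apply: le_lt_trans Bth.
  rewrite exprMn (_ : 4 * th = th ^+ 2 * (4 * th^-1)); last by field.
  by rewrite ltr_pM2l // exprn_gt0 //; lra.
have AE : A%:~R = th + w by rewrite /w; ring.
have BE : B%:~R = th * w + th^-1 by rewrite thw; ring.
clearbody w; split=> [x|].
  rewrite horner_cubic AE BE => x0.
  have : (x - th) * ((x - w / 2) ^+ 2 + (4 * th^-1 - w ^+ 2) / 4) = 0.
    by rewrite -[RHS]x0; field.
  move/eqP; rewrite mulf_eq0 subr_eq0 => /orP[/eqP //|/eqP h].
  have := sqr_ge0 (x - w / 2).
  by move: h; lra.
pose q := Num.sqrt (4 * th^-1 - w ^+ 2) / 2.
have q2 : q ^+ 2 = th^-1 - (w / 2) ^+ 2.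
  by rewrite /q expr_div_n sqr_sqrtr; [field | lra].
clearbody q; move: (w / 2) (esym (splitr w)) q2 => h wE q2.
rewrite -{w}wE in AE BE thw w4; pose g : R[i] := Complex h q; exists g.
have e1 : real_complex R th + g + conjc g = A%:~R.
  rewrite -(rmorph_int (real_complex R)) AE; apply/eqP; rewrite eq_complex /=.
  by apply/andP; split; apply/eqP; ring.
have e2 : real_complex R th * g + g * conjc g + conjc g * real_complex R th = B%:~R.
  rewrite -(rmorph_int (real_complex R)) BE; apply/eqP; rewrite eq_complex /=.
  have -> : th^-1 = q ^+ 2 + h ^+ 2 by rewrite q2; ring.
  by apply/andP; split; apply/eqP; ring.
have e3 : real_complex R th * g * conjc g = 1.
  apply/eqP; rewrite eq_complex /=.
  have -> : 1 = th * (q ^+ 2 + h ^+ 2) by rewrite q2 subrK divff.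
  by apply/andP; split; apply/eqP; ring.
split=> //; rewrite horner_cubic -e1 -e2 -[X in _ - X]e3.
by move: (real_complex R th) (conjc g) => x y; ring.
Qed.

Lemma exists_cubic_field (R : realType) (A B : int) (k : nat) :
  A + `|B| + 2 = k -> 1 <= A ->
  B = 0 \/ 3 * `|B| + 6 <= A /\ (`|B| + 1) ^+ 2 <= 4 * (A - 1) ->
  nonpower R A B ->
  exists (K : fieldExtType rat) (z : K),
  [/\ complex_cubic R K, is_unit z,
      z ^+ 3 - A%:~R * z ^+ 2 + B%:~R * z - 1 = 0,
      forall x, is_unit x -> exists (b : bool) (j : int), x = (-1) ^+ b * z ^ j &
      forall p : {poly int}, p != 0 -> (map_poly intr p).[z] = 0 -> (k <= l1 p)%N].
Proof.
move=> kE A1 hB np.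
have [th [th0 th1 Bth Ath]] := cubic_real_root R A1 hB.
have [uniq_th [g [g0 e1 e2 e3]]] := cubic_conjugates th0 th1 Bth.
have BA : B != A by case: hB; lia.
have AB : A + B != -2 by case: hB; lia.
pose f : {poly rat} := map_poly intr (cubic A B).
have sf : size f = 4%N by rewrite size_map_inj_poly ?size_cubic //; apply: intr_inj.
have irr_f : irreducible_poly f.
  by apply: cubic_irreducible; [rewrite sf | move=> x; apply: cubic_root_rat].
have [K dimK [z fz0 Kz]] := irredp_FAdjoin irr_f.
have fz : (map_poly intr (cubic A B)).[z] = 0.
  by move: fz0; rewrite /f map_poly_int_rat => /rootP.
have [s sz] : exists s : {rmorphism K -> R}, s z = th.
  by apply: embedding_exists Kz irr_f fz0 _; rewrite map_poly_ratr_int; apply/rootP.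
have [t tz] : exists t : {rmorphism K -> R[i]}, t z = g.
  by apply: embedding_exists Kz irr_f fz0 _; rewrite map_poly_ratr_int; apply/rootP.
have fzE : z ^+ 3 - A%:~R * z ^+ 2 + B%:~R * z - 1 = 0 by rewrite -horner_cubic.
have iz : is_integer z by exists (cubic A B); [exact: monic_cubic | apply/rootP].
have uz : is_unit z.
  split=> //; exists (z * z - A%:~R * z + B%:~R); last first.
    by apply/eqP; rewrite -subr_eq0 -[X in _ == X]fzE; apply/eqP; ring.
  have ii (m : int) : integralOver (intr : int -> K) m%:~R by apply: integral_id.
  apply: integral_add => //; apply: integral_sub; first exact: integral_mul.
  by apply: integral_mul.
have evs (F : numFieldType) (r : {rmorphism K -> F}) (p : {poly int}) :
    (map_poly intr p).[r z] = r (map_poly intr p).[z].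
  rewrite -horner_map -map_poly_comp; congr (_.[_]).
  by apply: eq_map_poly => x; rewrite /= rmorph_int.
exists K, z; split=> //.
- split; first by rewrite dimK sf.
  exists s => t' x.
  have t'z : t' z = s z by rewrite sz; apply: uniq_th; rewrite evs fz rmorph0.
  have /Fadjoin1_polyP[p ->] : x \in <<1; z>>%VS by rewrite Kz memvf.
  rewrite -!horner_map t'z -!map_poly_comp; congr (_.[_]).
  apply: eq_map_poly => c; transitivity (ratr c : R).
    exact: (fmorph_eq_rat (t' \o in_alg K) c).
  exact: (esym (fmorph_eq_rat (s \o in_alg K) c)).
- by apply: (@unit_group R K s t z A B); rewrite ?sz ?tz.
(* For [B = 0] the root [th > A] bounds the length. Otherwise [f] divides [p] over the rationals,
   hence over the integers as [f] is monic. *)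
move=> p p0 pz; case: (hB) => [B0|[AB3 _]].
  have AE : A = (absz A)%:Z by lia.
  have := @l1_root_ge R (absz A) th p; rewrite -sz evs pz rmorph0 sz.
  move=> h; have {h} := h _ (ltW th1) p0 erefl.
  rewrite pmulrn -AE => /(_ (Ath B0)); move: kE; rewrite B0; lia.
have : f %| map_poly intr p.
  apply: irreducible_root_dvdp irr_f fz0 _.
  by rewrite map_poly_int_rat; apply/rootP.
rewrite dvdp_rat_int => /(Pdiv.IdomainMonic.dvdpP (monic_cubic A B))[q pq].
have q0 : q != 0 by apply: contraNneq p0 => q0; rewrite pq q0 mul0r.
by have := l1_cubic_mul AB3 q0; rewrite -pq; apply: leq_trans; move: kE; lia.
Qed.

(** * Vanishing sums of units as integer polynomials *)

Lemma least_ge (P : nat -> Prop) (n : nat) :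
  (forall m, P m -> (n <= m)%N) -> ((n%:Z)%:E <= least P)%E.
Proof.
move=> hP; rewrite /least; case: pselect => [exP|_]; last exact: leey.
by case: ex_minnP => m /asboolP Pm _; rewrite lee_fin lez_nat hP.
Qed.

Lemma least_eq (P : nat -> Prop) (n : nat) :
  P n -> (forall m, P m -> (n <= m)%N) -> least P = (n%:Z)%:E.
Proof.
move=> Pn hP; rewrite /least; case: pselect => [exP|[]]; last first.
  by exists n; apply/asboolP.
case: ex_minnP => m /asboolP Pm min_m; congr (Posz _)%:E.
by apply/eqP; rewrite eqn_leq hP // min_m //; apply/asboolP.
Qed.

Section SignedMonomials.
Variables (I : finType) (J : {set I}) (b : I -> bool) (n : I -> nat).

Definition signed_monomials : {poly int} :=
  \sum_(i in J) (-1) ^+ b i *: 'X^(n i).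

Lemma l1_signed_monomials : (l1 signed_monomials <= #|J|)%N.
Proof.
rewrite (leq_trans (l1_sum _ _)) // -sum1_card leq_sum // => i _.
rewrite l1Z -['X^_]mul1r l1MXn /l1 size_poly1 big_ord1 coef1 abszX.
by case: (b i).
Qed.

(** Terms of exponent [n i0] all have the same sign, so that coefficient does not cancel. *)
Lemma signed_monomials_neq0 i0 : i0 \in J ->
  (forall i, i \in J -> n i = n i0 -> b i = b i0) -> signed_monomials != 0.
Proof.
move=> i0J same; apply/eqP => /(congr1 (fun p : {poly int} => p`_(n i0))).
rewrite coef0 coef_sum (eq_bigr (fun i => (-1) ^+ b i0 * (n i == n i0)%:R)); last first.
  move=> i iJ; rewrite coefZ coefXn eq_sym.
  by case: eqP => [/(same i iJ) ->|_]; rewrite ?mulr0.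
rewrite -mulr_sumr => /eqP; rewrite mulf_eq0 signr_eq0 /= -natr_sum.
by rewrite pnatr_eq0 (bigD1 i0) //= eqxx.
Qed.

(** The value at 1 is a sum of an odd number of signs, hence odd. *)
Lemma signed_monomials_odd : odd #|J| -> signed_monomials != 0.
Proof.
move=> oJ; apply/eqP => /(congr1 (fun p : {poly int} => p.[1])).
rewrite horner0 horner_sum (eq_bigr (fun i => 1 - 2 * (b i)%:R)); last first.
  by move=> i _; rewrite hornerZ hornerXn expr1n; case: (b i).
rewrite sumrB -mulr_sumr -natr_sum sumr_const; move: (\sum_(i in J) _)%N => c.
by move: oJ; rewrite !natz; move: #|J| => m; clear; lia.
Qed.

End SignedMonomials.

Lemma horner_signed_monomials (K : fieldExtType rat) (z : K) (I : finType)
    (J : {set I}) b n :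
  (map_poly intr (@signed_monomials I J b n)).[z] =
  \sum_(i in J) (-1) ^+ b i * z ^+ n i.
Proof.
rewrite /signed_monomials rmorph_sum horner_sum; apply: eq_bigr => i _.
by rewrite /= map_polyZ map_polyXn hornerZ hornerXn rmorphXn rmorphN1.
Qed.

Lemma regroup_terms (R : comPzRingType) (x y w c : R) (m n : nat) :
  - y *+ m + (c * x *+ n + (w - 1)) = w - m%:R * y + c * n%:R * x - 1.
Proof. by rewrite -[- y *+ m]mulr_natr -[c * x *+ n]mulr_natr; ring. Qed.

Section Ell.
Variables (K : fieldExtType rat) (z : K) (A B : int) (k : nat).
Hypotheses (k3 : (3 <= k)%N) (A1 : 1 <= A) (kE : A + `|B| + 2 = k)
  (uz : is_unit z) (fz : z ^+ 3 - A%:~R * z ^+ 2 + B%:~R * z - 1 = 0)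
  (units : forall x, is_unit x -> exists (b : bool) (j : int), x = (-1) ^+ b * z ^ j)
  (short : forall p : {poly int}, p != 0 -> (map_poly intr p).[z] = 0 -> (k <= l1 p)%N).

Lemma unit_sum_exponents m (e : 'I_m -> K) :
  (forall i, is_unit (e i)) -> exists (b : 'I_m -> bool) (n : 'I_m -> nat) (c : K),
  c != 0 /\ forall i, c * e i = (-1) ^+ b i * z ^+ n i.
Proof.
move=> ue; have [z0 _ _] := (is_unitP z).1 uz.
have [b hb] := choice (fun i => units (ue i)).
have [j hj] := choice hb.
(* Multiplication by [z^N] makes all exponents nonnegative. *)
pose N := (\sum_i `|j i|)%N.
have jN i : 0 <= N%:Z + j i.
  have : (`|j i| <= N)%N by rewrite /N (bigD1 i) //= leq_addr.
  by lia.
exists b, (fun i => absz (N%:Z + j i)%R), (z ^+ N); split; first by rewrite expf_neq0.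
move=> i; rewrite hj mulrCA; congr (_ * _).
by rewrite [RHS]exprnP gez0_abs // expfzDr.
Qed.

Lemma odd_unit_sum_ge m (e : 'I_m -> K) :
  odd m -> unit_vanishing_sum e -> (k <= m)%N.
Proof.
move=> om [ue se]; have [b [n [c [c0 ce]]]] := unit_sum_exponents ue.
rewrite -[m]card_ord -cardsT.
apply: leq_trans (l1_signed_monomials [set: 'I_m] b n).
apply: short; first by rewrite signed_monomials_odd // cardsT card_ord.
rewrite horner_signed_monomials (eq_bigl xpredT) => [|i]; last by rewrite inE.
under eq_bigr do rewrite -ce.
by rewrite -mulr_sumr se mulr0.
Qed.

(** Two terms with equal exponents and opposite signs would form a vanishing subsum, proper since
    [m >= 4]; so the associated polynomial is nonzero. *)
Lemma even_unit_sum_ge m (e : 'I_m -> K) : (4 <= m)%N ->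
  unit_vanishing_sum e -> ~ has_proper_vanishing_subsum e -> (k <= m)%N.
Proof.
move=> m4 [ue se] nsub; have [b [n [c [c0 ce]]]] := unit_sum_exponents ue.
rewrite -[m]card_ord -cardsT.
apply: leq_trans (l1_signed_monomials [set: 'I_m] b n).
apply: short; last first.
  rewrite horner_signed_monomials (eq_bigl xpredT) => [|i]; last by rewrite inE.
  under eq_bigr do rewrite -ce.
  by rewrite -mulr_sumr se mulr0.
have i0 : 'I_m by apply: (@Ordinal m 0); apply: leq_trans m4.
apply: (@signed_monomials_neq0 _ _ _ _ i0); rewrite ?inE // => i _ ni.
apply/eqP; apply/negPn/negP => bi; apply: nsub.
have ii0 : i != i0 by apply: contraNneq bi => ->.
exists [set i; i0]; split.
- by apply/set0Pn; exists i; rewrite !inE eqxx.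
- rewrite properT; apply/eqP => /(congr1 (fun S : {set _} => #|S|)).
  by rewrite cards2 ii0 cardsT card_ord; lia.
rewrite big_setU1 ?inE //= big_set1; apply: (mulfI c0).
rewrite mulr0 mulrDr !ce ni -mulrDl.
by move: bi; case: (b i); case: (b i0); rewrite //= ?expr0 ?expr1 ?addNr ?addrN mul0r.
Qed.

(* z^3 + |A| (-z^2) + |B| (+-z) + (-1) = 0 *)
Let sg (n : nat) : bool := (n == 2) || (n == 0) || ((n == 1) && (B < 0)).
Let exps : seq nat := nseq `|A| 2 ++ nseq `|B| 1 ++ [:: 3; 0].
Let ex (i : 'I_k) : nat := nth 0%N exps i.

Let size_exps : size exps = k.
Proof. by rewrite /exps !size_cat !size_nseq /=; move: kE A1; lia. Qed.

Definition short_sum (i : 'I_k) : K := (-1) ^+ sg (ex i) * z ^+ ex i.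

Lemma short_sum_vanishing : unit_vanishing_sum short_sum.
Proof.
split=> [i|].
  rewrite /short_sum; have uzn := is_unitX (ex i) uz.
  by case: (sg _); rewrite ?mul1r ?mulN1r //; apply: is_unitN.
pose F n : K := (-1) ^+ sg n * z ^+ n.
rewrite -(big_mkord xpredT (fun i => F (nth 0%N exps i))).
rewrite -{1}size_exps -(big_nth 0%N xpredT F) /F.
rewrite /exps !big_cat !big_nseq !iter_addr_0 !big_cons big_nil /sg /=.
rewrite -[RHS]fz mulN1r mul1r expr1 !expr0 mulN1r addr0.
have -> : A%:~R = (`|A|%N)%:R :> K by rewrite pmulrn gez0_abs // (le_trans _ A1).
have -> : B%:~R = (-1) ^+ (B < 0)%R * (`|B|%N)%:R :> K.
  rewrite pmulrn; case: (ltrP B 0) => B0.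
    by rewrite expr1 mulN1r ltz0_abs // rmorphN opprK.
  by rewrite expr0 mul1r gez0_abs.
exact: regroup_terms.
Qed.

(** In [short_sum] the exponent determines the sign, so a vanishing proper subsum would give a
    nonzero polynomial of length below [k] vanishing at [z]. *)
Lemma short_sum_no_subsum : ~ has_proper_vanishing_subsum short_sum.
Proof.
move=> [J [/set0Pn[i0 i0J] Jp J0]].
have := proper_card Jp; rewrite cardsT card_ord ltnNge => /negP; apply.
apply: leq_trans (l1_signed_monomials J (sg \o ex) ex); apply: short.
  by apply: (signed_monomials_neq0 i0J) => i _ /= ->.
by rewrite horner_signed_monomials -[RHS]J0.
Qed.

(** Both [od] and [ev] are at least [k], and [short_sum] attains [k] in the one matching the parity
    of [k]. *)
Lemma ell_eq : ell K = (k%:Z)%:E.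
Proof.
have od_ge : ((k%:Z)%:E <= od K)%E.
  by apply: least_ge => m [om m3 [e he]]; apply: odd_unit_sum_ge om he.
have ev_ge : ((k%:Z)%:E <= ev K)%E.
  by apply: least_ge => m [om m4 [e [he hs]]]; apply: even_unit_sum_ge m4 he hs.
have [ok|ek] := boolP (odd k).
  have -> : ell K = od K.
    apply/min_idPl; suff -> : od K = (k%:Z)%:E by [].
    apply: least_eq; first by split=> //; exists short_sum; apply: short_sum_vanishing.
    by move=> m [om m3 [e he]]; apply: odd_unit_sum_ge om he.
  apply: least_eq; first by split=> //; exists short_sum; apply: short_sum_vanishing.
  by move=> m [om m3 [e he]]; apply: odd_unit_sum_ge om he.
have evE : ev K = (k%:Z)%:E.
  apply: least_eq; last first.
    by move=> m [om m4 [e [he hs]]]; apply: even_unit_sum_ge m4 he hs.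
  split=> //; first by move: k3 ek; rewrite leq_eqVlt => /orP[/eqP <-|].
  exists short_sum; split; [exact: short_sum_vanishing | exact: short_sum_no_subsum].
by rewrite /ell evE; apply/min_idPr.
Qed.

End Ell.

Theorem theorem3 (R : realType) (k : nat) (hk : (3 <= k)%N)
    (hform : ~ exists t : int,
       [/\ t != 0, t != 1 & k%:Z = 4 * t ^+ 4 - 4 * t + 2]) :
  exists K : fieldExtType rat, complex_cubic R K /\ ell K = (k%:Z)%:E.
Proof.
have [A [B [kE A1 hB np]]] := exists_nonpower R hk hform.
have [K [z [cK uz fz units short]]] := exists_cubic_field kE A1 hB np.
by exists K; split=> //; apply: (ell_eq hk A1 kE uz fz units short).
Qed.
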